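(* Let $u\in U_{ad}$ be a minimizer over $U_{ad}$ of the reduced functional $\hat J(u)=j_1(u)+\beta j_2(u)$, let $y=\mathcal S(f+u)$ be the associated state (so that $(y,u)$ is an optimal solution of the control problem), and let $p\in\widetilde H^{\frac{\alpha}{2}}(\Omega)$ be the adjoint state, i.e. the solution of $$a(w,p)=(y-y_d,w)\qquad\forall w\in\widetilde H^{\frac{\alpha}{2}}(\Omega).$$ Then there exists $\lambda\in\partial j_2(u)$ such that $$(p+\gamma u+\beta\lambda,\,v-u)\ge 0\qquad\forall v\in U_{ad}.$$
   Context: $\Omega\subset\mathbb R^d$ is a bounded Lipschitz domain, $\Omega^c=\mathbb R^d\setminus\overline\Omega$, $0<\alpha<2$, $\gamma>0$, $\beta>0$, $a,b\in\mathbb R$ with $a<0<b$, and $f,y_d\in L^2(\Omega)$. $(\cdot,\cdot)$ and $\|\cdot\|$ denote the inner product and norm of $L^2(\Omega)$. $\widetilde H^{\frac{\alpha}{2}}(\Omega)=\{v\in H^{\frac{\alpha}{2}}(\mathbb R^d): v=0 \text{ in }\Omega^c\}$, with bilinear form $$a(y,v)=\frac{C(d,\alpha)}{2}\iint_{\mathbb R^d\times\mathbb R^d}\frac{(y(x)-y(w))(v(x)-v(w))}{|x-w|^{d+\alpha}}\,dx\,dw,\qquad C(d,\alpha)=\frac{2^\alpha\Gamma(\frac{\alpha}{2}+\frac d2)}{\pi^{d/2}|\Gamma(-\frac\alpha2)|}.$$ The solution operator $\mathcal S:L^2(\Omega)\to\widetilde H^{\frac{\alpha}{2}}(\Omega)$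 of the fractional Laplace equation is defined by: $\mathcal S g$ is the unique element of $\widetilde H^{\frac{\alpha}{2}}(\Omega)$ with $a(\mathcal S g,v)=(g,v)$ for all $v\in\widetilde H^{\frac{\alpha}{2}}(\Omega)$. $U_{ad}=\{v\in L^2(\Omega): a\le v\le b\text{ a.e. in }\Omega\}$. The functionals are $$j_1(u)=\tfrac12\|\mathcal S(f+u)-y_d\|^2+\tfrac\gamma2\|u\|^2,\qquad j_2(u)=\|u\|_{L^1(\Omega)}.$$ The subdifferential is $\partial j_2(u)=\{\lambda\in L^2(\Omega): j_2(w)-j_2(u)\ge(\lambda,w-u)\ \forall w\in L^2(\Omega)\}$. *)

(* Defs.v *)
From HB Require Import structures.
From mathcomp Require Import all_boot all_order all_algebra.
From mathcomp Require Import all_classical all_reals all_analysis.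

Set Implicit Arguments.
Unset Strict Implicit.
Unset Printing Implicit Defensive.

Import Order.TTheory GRing.Theory Num.Theory.
Import numFieldNormedType.Exports.

Local Open Scope classical_set_scope.
Local Open Scope ring_scope.

(* R^n is 'rV[R]_n with the topology of the library; below it gets the sigma-algebra
   generated by the coordinates (the Borel sets) and Lebesgue measure. *)

Definition rV_display : measure_display -> measure_display.
Proof. exact. Qed.

Section measurable_rV.
Context {d} {T : sigmaRingType d}.
Variable n : nat.

Let coord_rV : 'I_n -> 'rV[T]_n -> T := fun i x => x ord0 i.

Let rV_set0 : g_sigma_preimage coord_rV set0.
Proof. exact: sigma_algebra0. Qed.

Let rV_setC A : g_sigma_preimage coord_rV A -> g_sigma_preimage coord_rV (~` A).
Proof. exact: sigma_algebraC. Qed.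

Let rV_bigcup (F : _^nat) : (forall i, g_sigma_preimage coord_rV (F i)) ->
  g_sigma_preimage coord_rV (\bigcup_i (F i)).
Proof. exact: sigma_algebra_bigcup. Qed.

HB.instance Definition _ := @isMeasurable.Build (rV_display d)
  'rV[T]_n (g_sigma_preimage coord_rV) rV_set0 rV_setC rV_bigcup.

End measurable_rV.

Section measurable_rV_theory.

Lemma measurable_coord_rV d (T : sigmaRingType d) n (i : 'I_n) :
  measurable_fun [set: 'rV[T]_n] (fun x => x ord0 i).
Proof.
move=> _ Y mY; rewrite setTI; apply: sub_sigma_algebra => /=.
rewrite -bigcup_seq/=; exists i => /=; first by rewrite mem_index_enum.
by exists Y => //; rewrite setTI.
Qed.

Context d1 d2 (T1 : measurableType d1) (T2 : measurableType d2).

Lemma measurable_fun_rVP n (f : T1 -> 'rV[T2]_n) :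
  measurable_fun [set: T1] f <->
  forall i, measurable_fun [set: T1] (fun x => f x ord0 i).
Proof.
split=> [mf i|mf].
  by apply: (measurableT_comp (f := fun x : 'rV[T2]_n => x ord0 i)) => //;
    exact: measurable_coord_rV.
move=> _; apply: smallest_sub.
  split=> /=.
  - by rewrite setTI preimage_set0.
  - move=> A; rewrite !setTI setTD => mA.
    by rewrite -preimage_setC; exact: measurableC.
  - move=> F mF; rewrite setTI preimage_bigcup.
    by apply: bigcupT_measurable => i; have := mF i; rewrite setTI.
move=> A; rewrite -bigcup_seq => -[i _ [B mB <-]] /=.
by rewrite !setTI; have := mf i measurableT B mB; rewrite setTI.
Qed.

End measurable_rV_theory.

Section lebesgue_rV.
Context {R : realType}.

Definition cons_rV n (z : measurableTypeR R * 'rV[R]_n) : 'rV[R]_n.+1 :=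
  row_mx (z.1%:M : 'rV_1) z.2.

Lemma cons_rV0 n (z : measurableTypeR R * 'rV[R]_n) : cons_rV z ord0 ord0 = z.1.
Proof.
transitivity (row_mx (z.1%:M : 'rV_1) z.2 ord0 (lshift n ord0)).
  by congr (row_mx _ _ _ _); exact/val_inj.
by rewrite row_mxEl mxE mulr1n.
Qed.

Lemma cons_rVS n (z : measurableTypeR R * 'rV[R]_n) (j : 'I_n) :
  cons_rV z ord0 (lift ord0 j) = z.2 ord0 j.
Proof.
transitivity (row_mx (z.1%:M : 'rV_1) z.2 ord0 (rshift 1 j)).
  by congr (row_mx _ _ _ _); exact/val_inj.
by rewrite row_mxEr.
Qed.

Lemma measurable_cons_rV n : measurable_fun setT (@cons_rV n).
Proof.
apply/measurable_fun_rVP => i.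
have [->|[j ->]] : i = ord0 \/ exists j, i = lift ord0 j.
  by case: (unliftP ord0 i) => [j ->|->]; [right; exists j|left].
  by under eq_fun do rewrite cons_rV0; exact: measurable_fst.
under eq_fun do rewrite cons_rVS.
apply: (measurableT_comp (f := fun x : 'rV[R]_n => x ord0 j)) => //.
exact: measurable_coord_rV.
Qed.

Definition uncons_rV n (x : 'rV[R]_n.+1) : measurableTypeR R * 'rV[R]_n :=
  (x ord0 ord0, \row_j x ord0 (lift ord0 j)).

Lemma cons_rVK n : cancel (@cons_rV n) (@uncons_rV n).
Proof.
move=> [t x]; rewrite /uncons_rV cons_rV0; congr pair.
by apply/rowP => j; rewrite mxE cons_rVS.
Qed.

Lemma measurable_uncons_rV n : measurable_fun setT (@uncons_rV n).
Proof.
apply/measurable_fun_pairP; split.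
  exact: (measurable_coord_rV (T := measurableTypeR R)).
apply/measurable_fun_rVP => i; rewrite /uncons_rV /comp /=.
under eq_fun do rewrite mxE.
exact: measurable_coord_rV.
Qed.

(* Iterated product of the one-dimensional Lebesgue measure, transported along
   R * R^n ~ R^(n+1). *)
Fixpoint lebesgue_rV n : set 'rV[R]_n -> \bar R :=
  match n with
  | 0%N => \d_(0 : 'rV[R]_0)
  | m.+1 => pushforward (lebesgue_measure \x @lebesgue_rV m)%E (@cons_rV m)
  end.

Section pushforward_cons.
Local Open Scope ereal_scope.
Variables (n : nat) (mu : {sigma_finite_measure set 'rV[R]_n -> \bar R}).

Let nu : set 'rV[R]_n.+1 -> \bar R :=
  pushforward (lebesgue_measure \x mu) (@cons_rV n).

Let mpreimage (A : set 'rV[R]_n.+1) :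
  measurable A -> measurable (@cons_rV n @^-1` A).
Proof. by rewrite -[X in _ -> measurable X]setTI; exact: measurable_cons_rV. Qed.

Let nu0 : nu set0 = 0.
Proof. by rewrite /nu /pushforward preimage_set0 measure0. Qed.

Let nu_ge0 A : 0 <= nu A.
Proof. exact: (measure_ge0 (lebesgue_measure \x mu)). Qed.

Let nu_sigma_additive : semi_sigma_additive nu.
Proof.
move=> F mF tF mUF; rewrite /nu /pushforward preimage_bigcup.
apply: (@measure_semi_sigma_additive _ _ _ (lebesgue_measure \x mu)).
- by move=> k; exact: mpreimage.
- apply/trivIsetP => /= i j _ _ ij; rewrite -preimage_setI.
  by move/trivIsetP : tF => /(_ _ _ _ _ ij) ->//; rewrite preimage_set0.
- by rewrite -preimage_bigcup; exact: mpreimage.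
Qed.

Definition pushforward_cons_rV : set 'rV[R]_n.+1 -> \bar R := nu.

HB.instance Definition _ := isMeasure.Build _ _ _ pushforward_cons_rV
  nu0 nu_ge0 nu_sigma_additive.

Let nu_sigma_finite : sigma_finite setT pushforward_cons_rV.
Proof.
have /sigma_finiteP[F [TF ndF Foo]] := sigma_finiteT (@lebesgue_measure R).
have /sigma_finiteP[G [TG ndG Goo]] := sigma_finiteT mu.
exists (fun k => @uncons_rV n @^-1` (F k `*` G k)).
  apply/esym; rewrite -subTset => x _.
  have [i _ Fi] : (\bigcup_i F i) (uncons_rV x).1 by rewrite -TF.
  have [j _ Gj] : (\bigcup_i G i) (uncons_rV x).2 by rewrite -TG.
  exists (maxn i j) => //; split.
    by move: Fi; exact/subsetPset/ndF/leq_maxl.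
  by move: Gj; exact/subsetPset/ndG/leq_maxr.
move=> k; have [mF Fk] := Foo k; have [mG Gk] := Goo k; split.
  by rewrite -[X in measurable X]setTI; apply: measurable_uncons_rV => //;
    exact: measurableX.
rewrite /pushforward_cons_rV /nu /pushforward -comp_preimage.
rewrite (_ : _ \o _ = id); last by apply/funext => z /=; rewrite cons_rVK.
by rewrite preimage_id product_measure1E// lte_mul_pinfty// ge0_fin_numE.
Qed.

HB.instance Definition _ := Measure_isSigmaFinite.Build _ _ _
  pushforward_cons_rV nu_sigma_finite.

End pushforward_cons.

Lemma lebesgue_rV_ex n : exists mu : {sigma_finite_measure set 'rV[R]_n -> \bar R},
  @lebesgue_rV n = mu.
Proof.
elim: n => [|n [mu muE]]; first by exists \d_(0 : 'rV[R]_0).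
by exists (pushforward_cons_rV mu); rewrite /= muE.
Qed.

Section instances.
Variable n : nat.
Local Open Scope ereal_scope.

Let l0 : @lebesgue_rV n set0 = 0.
Proof. by have [mu ->] := lebesgue_rV_ex n; exact: measure0. Qed.

Let l_ge0 A : 0 <= @lebesgue_rV n A.
Proof. by have [mu ->] := lebesgue_rV_ex n; exact: measure_ge0. Qed.

Let l_sigma_additive : semi_sigma_additive (@lebesgue_rV n).
Proof.
by have [mu ->] := lebesgue_rV_ex n; exact: measure_semi_sigma_additive.
Qed.

HB.instance Definition _ := isMeasure.Build _ _ _ (@lebesgue_rV n)
  l0 l_ge0 l_sigma_additive.

Let l_sigma_finite : sigma_finite setT (@lebesgue_rV n).
Proof. by have [mu ->] := lebesgue_rV_ex n; exact: sigma_finiteT. Qed.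

HB.instance Definition _ := Measure_isSigmaFinite.Build _ _ _
  (@lebesgue_rV n) l_sigma_finite.

End instances.

Lemma lebesgue_rV_box n (A : 'I_n -> set R) : (forall i, measurable (A i)) ->
  lebesgue_rV [set x : 'rV[R]_n | forall i, A i (x ord0 i)] =
  (\prod_(i < n) lebesgue_measure (A i : set (measurableTypeR R)))%E.
Proof.
elim: n A => [|n IHn] A mA.
  rewrite big_ord0 /= diracE mem_set//; first by case.
rewrite big_ord_recl /= /pushforward.
rewrite (_ : _ @^-1` _ = (A ord0 : set (measurableTypeR R)) `*`
    [set x : 'rV[R]_n | forall i, A (lift ord0 i) (x ord0 i)]).
  rewrite product_measure1E//.
    congr (_ * _)%E; exact: (IHn (fun i => A (lift ord0 i))).
    exact: mA.
  rewrite (_ : [set x | _] = \bigcap_(i in [set: 'I_n])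
      ((fun x : 'rV[R]_n => x ord0 i) @^-1` A (lift ord0 i))).
    apply: fin_bigcap_measurable => // i _.
    by rewrite -[X in measurable X]setTI; exact: measurable_coord_rV.
  by apply/seteqP; split => x /= Ax i; [move=> _|]; exact: Ax.
apply/seteqP; split => [z /= Az|z [/= A0 AS] i].
  by split; [rewrite -(cons_rV0 z)|move=> i /=; rewrite -cons_rVS].
have [->|[j ->]] : i = ord0 \/ exists j, i = lift ord0 j.
  by case: (unliftP ord0 i) => [j ->|->]; [right; exists j|left].
  by rewrite cons_rV0.
by rewrite cons_rVS.
Qed.

End lebesgue_rV.

Section gamma.
Context {R : realType}.
Implicit Types z : R.

Definition euler_gamma z : R :=
  \int[lebesgue_measure]_(t in `]0, +oo[%classic) (t `^ (z - 1) * expR (- t)).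

(* For z <= 0 (not an integer), Gamma z = Gamma (z + n) / (z (z + 1) ... (z + n - 1)),
   with n least such that z + n > 0. *)
Definition Gamma z : R :=
  let n := if 0 < z then 0%N else (Num.truncn (- z)).+1 in
  euler_gamma (z + n%:R) / \prod_(k < n) (z + k%:R).

End gamma.

Section euclidean.
Context {R : realType}.

(* The norm `|x| of the library on row vectors is the sup norm. *)
Definition enorm n (x : 'rV[R]_n) : R := Num.sqrt (\sum_i x ord0 i ^+ 2).

Definition boundary n (O : set 'rV[R]_n) : set 'rV[R]_n := closure O `\` O°.

(* Up to an orthogonal change Q of coordinates, O is, in a ball around any of its
   boundary points, the part of the ball above the graph of a Lipschitz function phi
   of n - 1 of the coordinates; [col' i] deletes the i-th coordinate. *)
Definition lipschitz_boundary n (O : set 'rV[R]_n) :=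
  forall x0, boundary O x0 ->
  exists (Q : 'M[R]_n) (i : 'I_n) (phi : 'rV[R]_n.-1 -> R^o) (L r : R),
    [/\ Q *m Q^T = 1%:M, L.-lipschitz phi, 0 < r &
        forall x, enorm (x - x0) < r ->
          O x <-> phi (col' i (x *m Q)) < (x *m Q) ord0 i].

Definition bounded_lipschitz_domain n (O : set 'rV[R]_n) :=
  [/\ O !=set0, open O, connected O, bounded_set O & lipschitz_boundary O].

End euclidean.

(* Elements of L^2(O) are represented by functions on R^d whose values outside O are
   irrelevant, elements of H^s(R^d) by functions on R^d. *)
Section L2_domain.
Context {R : realType} {d : nat}.
Implicit Types (O : set 'rV[R]_d) (u v w g : 'rV[R]_d -> R).

Definition L2 O : set ('rV[R]_d -> R) :=
  [set g | g \_ O \in Lfun (@lebesgue_rV R d) 2%:E].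

Definition L2dot O g v : R := \int[@lebesgue_rV R d]_(x in O) (g x * v x).

Definition L2norm O g : R := fine 'N[@lebesgue_rV R d]_2[EFin \o g \_ O].

Definition L1norm O g : R := fine 'N[@lebesgue_rV R d]_1[EFin \o g \_ O].

End L2_domain.

Section fractional_laplacian.
Context {R : realType} {d : nat}.
Implicit Types (O : set 'rV[R]_d) (alpha : R) (u v w y g : 'rV[R]_d -> R).

Local Notation leb := (@lebesgue_rV R d).

Definition gagliardo_weight alpha (z : 'rV[R]_d * 'rV[R]_d) : R :=
  enorm (z.1 - z.2) `^ (d%:R + alpha).

(* H^(alpha/2)(R^d), for 0 < alpha < 2 *)
Definition Hs alpha : set ('rV[R]_d -> R) :=
  [set v | v \in Lfun leb 2%:E /\
    (\int[leb \x leb]_z ((v z.1 - v z.2) ^+ 2 / gagliardo_weight alpha z)%:E < +oo)%E].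

Definition Htilde O alpha : set ('rV[R]_d -> R) :=
  [set v | Hs alpha v /\ {ae leb, forall x, ~ closure O x -> v x = 0}].

Definition Cda alpha : R :=
  2 `^ alpha * Gamma (alpha / 2 + d%:R / 2) /
  (pi `^ (d%:R / 2) * `|Gamma (- (alpha / 2))|).

Definition bilin alpha y v : R :=
  Cda alpha / 2 *
  \int[(leb \x leb)%E]_z
    ((y z.1 - y z.2) * (v z.1 - v z.2) / gagliardo_weight alpha z).

Definition weak_solution O alpha g y :=
  Htilde O alpha y /\
  forall v, Htilde O alpha v -> bilin alpha y v = L2dot O g v.

(* "The" element of Htilde is a class modulo a.e. equality; [xget] picks a
   representative. *)
Definition solution_operator O alpha g : 'rV[R]_d -> R :=
  xget (cst 0) [set y | weak_solution O alpha g y].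

End fractional_laplacian.

Section control_problem.
Context {R : realType} {d : nat}.
Variables (O : set 'rV[R]_d) (alpha gamma beta a b : R) (f yd : 'rV[R]_d -> R).
Implicit Types u v w : 'rV[R]_d -> R.

Definition Uad : set ('rV[R]_d -> R) :=
  [set v | L2 O v /\
    {ae @lebesgue_rV R d, forall x, O x -> a <= v x <= b}].

Definition j1 u : R :=
  2^-1 * L2norm O (solution_operator O alpha (f \+ u) \- yd) ^+ 2 +
  gamma / 2 * L2norm O u ^+ 2.

Definition j2 u : R := L1norm O u.

Definition subdiff_j2 u : set ('rV[R]_d -> R) :=
  [set lambda | L2 O lambda /\
    forall w, L2 O w -> j2 w - j2 u >= L2dot O lambda (w \- u)].

Definition Jhat u : R := j1 u + beta * j2 u.

Definition adjoint_state (y p : 'rV[R]_d -> R) :=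
  Htilde O alpha p /\
  forall w, Htilde O alpha w -> bilin alpha w p = L2dot O (y \- yd) w.

End control_problem.

(* Main.v *)
Require Import Defs.
From mathcomp Require Import all_boot all_order all_algebra.
From mathcomp Require Import all_classical all_reals all_analysis.
From mathcomp Require Import measurable_realfun ring lra.

(**
The map [u |-> S (f + u)] is affine because weak solutions exist for every right-hand
side (minimization of the Dirichlet energy on the Hilbert space [Htilde]) and are unique
(fractional Poincare inequality). Hence [j1] is a quadratic polynomial along segments
and, with the convexity of [j2], minimality of [u] gives, for [q := p + gamma u] and every
admissible [v],
  [(q, v - u) + beta (j2 v - j2 u) >= 0].
No abstract subdifferential calculus is needed: testing with the pointwise minimizer [w]
of [s |-> q(x) s + beta |s|] over [a, b] makes the integrand nonpositive a.e., so it
vanishes a.e. and [u x] is itself such a minimizer for a.e. [x]. Then [lambda], the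
truncation of [- q / beta] to [-1, 1], satisfies [lambda u = |u|] and
[(q + beta lambda) (s - u) >= 0] for all [s] in [a, b], a.e. in [Omega].
*)

Set Implicit Arguments.
Unset Strict Implicit.
Unset Printing Implicit Defensive.

Import Order.TTheory GRing.Theory Num.Theory.
Import numFieldNormedType.Exports.

Local Open Scope classical_set_scope.
Local Open Scope ring_scope.

(** * Riesz representation by energy minimization *)

(** Replaces passages to the limit in a step size: later variations use the steps [1 / 2 ^ n]. *)
Lemma le0_of_le_expr2N (R : realType) (r C : R) :
  (forall n, r <= C * (2 ^+ n)^-1) -> r <= 0.
Proof.
move=> rC; rewrite leNgt; apply/negP => r0.
have C0 : 0 < C by have := rC 0%N; rewrite expr0 invr1 mulr1; lra.
have [n Cn] : exists n : nat, C / r < n%:R.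
  by exists (Num.truncn (C / r)).+1; rewrite truncnS_gt.
have n2n : (n%:R : R) <= 2 ^+ n by rewrite -natrX ler_nat ltnW// ltn_expl.
have := rC n; rewrite leNgt => /negP; apply.
rewrite ltr_pdivrMr ?exprn_gt0// -ltr_pdivrMl// mulrC.
exact: lt_le_trans n2n.
Qed.

Section riesz.
Context {R : realType} {V : lmodType R}.
Variables (X : set V) (B : V -> V -> R) (l : V -> R) (K : R).
Hypothesis X0 : X 0.
Hypothesis XP : forall t u v, X u -> X v -> X (t *: u + v).
Hypothesis B_sym : forall u v, X u -> X v -> B u v = B v u.
Hypothesis B_lin : forall t u v w, X u -> X v -> X w ->
  B (t *: u + v) w = t * B u w + B v w.
Hypothesis B_ge0 : forall u, X u -> 0 <= B u u.
Hypothesis l_lin : forall t u v, X u -> X v -> l (t *: u + v) = t * l u + l v.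
Hypothesis l_le : forall u, X u -> l u <= K + B u u / 2.
Hypothesis B_complete : forall (v_ : nat -> V) M, (forall n, X (v_ n)) ->
  (forall n m, (n <= m)%N -> B (v_ m - v_ n) (v_ m - v_ n) <= M * (8 ^+ n)^-1) ->
  exists2 v, X v & forall n, B (v_ n - v) (v_ n - v) <= M * (8 ^+ n)^-1.

Let energy u := B u u / 2 - l u.

Let B_sqrD t u v : X u -> X v ->
  B (t *: u + v) (t *: u + v) = t ^+ 2 * B u u + 2 * t * B u v + B v v.
Proof.
move=> Xu Xv; have Xw := XP t Xu Xv.
rewrite B_lin// (B_sym Xu Xw) (B_sym Xv Xw) !B_lin// (B_sym Xv Xu); ring.
Qed.

Let XZ t u : X u -> X (t *: u).
Proof. by move=> Xu; rewrite -[_ *: _]addr0; exact: XP. Qed.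

Let B0 w : X w -> B 0 w = 0.
Proof.
by move=> Xw; have := B_lin (-1) X0 X0 Xw; rewrite scaler0 addr0; lra.
Qed.

Let BZ t u w : X u -> X w -> B (t *: u) w = t * B u w.
Proof.
by move=> Xu Xw; rewrite -[t *: u]addr0 B_lin// B0// addr0.
Qed.

Let lZ t u : X u -> l (t *: u) = t * l u.
Proof.
move=> Xu; rewrite -[t *: u]addr0 l_lin//.
by have := l_lin (-1) X0 X0; rewrite scaler0 addr0; lra.
Qed.

Let energyD t u v : X u -> X v -> energy (t *: u + v) =
  t ^+ 2 * B u u / 2 + t * (B u v - l u) + energy v.
Proof. by move=> Xu Xv; rewrite /energy B_sqrD// l_lin//; field. Qed.

Let energyZ t u : X u -> energy (t *: u) = t ^+ 2 * B u u / 2 - t * l u.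
Proof.
move=> Xu; rewrite /energy lZ// BZ//; last exact: XZ.
by rewrite B_sym// ?BZ//; [ring|exact: XZ].
Qed.

(** Direct method: near-minimizers of the energy are [B]-Cauchy, and the first variation vanishes at
    a limit. [l_le] bounds the energy below by [- K]. [B] is only assumed semidefinite, which allows
    functions in place of classes modulo a.e. equality. *)
Lemma riesz_representation : exists2 v, X v & forall w, X w -> B v w = l w.
Proof.
pose E := [set energy u | u in X]; pose m := inf E.
have E_inf : has_inf E.
  split; first by exists (energy 0), 0.
  by exists (- K) => _ [u Xu <-]; rewrite /energy; have := l_le Xu; lra.
have m_le u : X u -> m <= energy u.
  by move=> Xu; apply: ge_inf; [exact: E_inf.2|exists u].
have /choice[v_ v_min] n :
    exists v, X v /\ energy v <= m + (8 ^+ n)^-1.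
  have e0 : 0 < ((8 ^+ n)^-1 : R) by rewrite invr_gt0 exprn_gt0.
  have [_ [u Xu <-] /ltW um] := inf_adherent e0 E_inf.
  by exists u.
have Xv n := (v_min n).1; have Ev n := (v_min n).2.
(* Both energies are within [1 / 8 ^ n] of [m], and the midpoint lies below their mean by
   [B (v_ k - v_ n) (v_ k - v_ n) / 8]; hence the factor 8. *)
have [||v Xv0 v_lim] := @B_complete v_ 8 => //.
  (* Parallelogram identity: the midpoint of two near-minimizers has energy >= m. *)
  move=> n k nk.
  have mid : m <= energy (2^-1 *: v_ n + 2^-1 *: v_ k).
    by apply: m_le; apply: XP => //; exact: XZ.
  have Bkn : B (v_ n) (2^-1 *: v_ k) = 2^-1 * B (v_ n) (v_ k).
    by rewrite B_sym ?BZ// ?(B_sym (Xv k) (Xv n))//; exact: XZ.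
  move: mid; rewrite energyD//; last exact: XZ.
  rewrite energyZ// Bkn.
  have -> : v_ k - v_ n = (-1) *: v_ n + v_ k by rewrite scaleN1r addrC.
  rewrite B_sqrD// => mid.
  have ek : ((8 ^+ k)^-1 : R) <= (8 ^+ n)^-1.
    by rewrite lef_pV2 ?posrE ?exprn_gt0// ler_weXn2l// ler1n.
  by have := Ev n; have := Ev k; rewrite /energy; lra.
exists v => // w Xw; apply/eqP; rewrite -subr_eq0 -normr_le0.
(* With the step [s = 1 / 2 ^ n], near-minimality of [v_ n] bounds [|B w (v_ n) - l w|] by
   [s * B w w / 2 + s ^ 2], and positivity of [B] bounds [|B w (v_ n - v)|] by
   [s * B w w / 2 + 4 * s ^ 2]. Since [s <= 1], the sum is at most [(B w w + 5) * s]. *)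
apply: (@le0_of_le_expr2N _ _ (B w w + 5)) => n.
set s : R := (2 ^+ n)^-1.
have s0 : 0 < s by rewrite invr_gt0 exprn_gt0.
have s1 : s <= 1 by rewrite invf_le1 ?exprn_gt0// exprn_ege1// ler1n.
have s8 : (8 ^+ n)^-1 = s * (s * s).
  by rewrite /s -!invfM -!exprMn; congr (_ ^+ _)^-1; lra.
have Xvn : X (v_ n - v) by rewrite addrC -scaleN1r; exact: XP.
have bvn t : - (t * (B w (v_ n) - l w)) <= t ^+ 2 * B w w / 2 + s * (s * s).
  by rewrite -s8; have := energyD t Xw (Xv n); have := Ev n;
    have := m_le _ (XP t Xw (Xv n)); lra.
have bv t : - (2 * t * B w (v_ n - v)) <= t ^+ 2 * B w w + 8 * (s * (s * s)).
  by have := B_ge0 (XP t Xw Xvn); have := v_lim n; rewrite B_sqrD// s8; lra.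
have -> : B v w - l w = (B w (v_ n) - l w) - B w (v_ n - v).
  rewrite (B_sym Xw Xvn) (B_sym Xw (Xv n)).
  by rewrite (_ : v_ n - v = (-1) *: v + v_ n) ?B_lin//; [ring|
    rewrite scaleN1r addrC].
have Bww := B_ge0 Xw.
have scale (x y : R) : s * x <= s * y -> x <= y by rewrite ler_pM2l.
have ss : 0 <= s * s by rewrite mulr_ge0 // ltW.
have sss : s * s <= s by rewrite ler_piMr // ltW.
have p1 := bvn s; have p2 := bvn (- s); have p3 := bv s; have p4 := bv (- s).
have q1 : - (B w (v_ n) - l w) <= s * B w w / 2 + s * s.
  by apply: scale; move: p1; rewrite expr2; lra.
have q2 : (B w (v_ n) - l w) <= s * B w w / 2 + s * s.
  by apply: scale; move: p2; rewrite expr2; lra.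
have q3 : - (2 * B w (v_ n - v)) <= s * B w w + 8 * (s * s).
  by apply: scale; move: p3; rewrite expr2; lra.
have q4 : 2 * B w (v_ n - v) <= s * B w w + 8 * (s * s).
  by apply: scale; move: p4; rewrite expr2; lra.
by rewrite ler_norml; apply/andP; split; lra.
Qed.

End riesz.

(** * Square-integrable functions *)

Section square_integrable.
Context d (T : measurableType d) (R : realType).
Variable mu : {measure set T -> \bar R}.
Implicit Types f g h : T -> R.

Lemma Lfun2P f : f \in Lfun mu 2%:E <->
  measurable_fun setT f /\ (\int[mu]_x (f x ^+ 2)%:E < +oo)%E.
Proof.
split=> [fL|[mf foo]].
  have /integrableP[_ foo] := Lfun2_integrable_sqr fL.
  split; first by have := set_mem (sub_Lfun_mfun fL).
  apply: le_lt_trans foo; rewrite le_eqVlt; apply/orP; left; apply/eqP.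
  by apply: eq_integral => x _ /=; rewrite ger0_norm// sqr_ge0.
apply/andP; split; apply/mem_set => //=; rewrite /finite_norm unlock /Lnorm.
apply: poweR_lty.
under eq_integral => x _ do rewrite abse_EFin poweR_EFin powR_mulrn// -normrX
  ger0_norm ?sqr_ge0//.
exact: foo.
Qed.

Lemma measurable_Lfun2 f : f \in Lfun mu 2%:E -> measurable_fun setT f.
Proof. by case/Lfun2P. Qed.

Lemma Lnorm2_sqr f : f \in Lfun mu 2%:E ->
  fine 'N[mu]_2[EFin \o f] ^+ 2 = \int[mu]_x (f x * f x).
Proof.
move=> fL; have [_ foo] := (Lfun2P f).1 fL.
have f0 : (0 <= \int[mu]_x (f x ^+ 2)%:E)%E.
  by apply: integral_ge0 => x _; rewrite lee_fin sqr_ge0.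
rewrite unlock /Lnorm.
under eq_integral => x _ do rewrite abse_EFin poweR_EFin powR_mulrn// -normrX
  ger0_norm ?sqr_ge0//.
rewrite /Rintegral; under [in RHS]eq_integral => x _ do rewrite -expr2.
have /fineK <- : (\int[mu]_x (f x ^+ 2)%:E)%E \is a fin_num.
  by rewrite ge0_fin_numE.
rewrite poweR_EFin /= powR12_sqrt ?fine_ge0// sqr_sqrtr// fine_ge0//.
Qed.

Lemma integrable_mul_Lfun2 f g : f \in Lfun mu 2%:E -> g \in Lfun mu 2%:E ->
  mu.-integrable setT (fun x => (f x * g x)%:E).
Proof. by move=> fL gL; apply/Lfun1_integrable/Lfun2_mul_Lfun1. Qed.

Lemma Rintegral_mul_lin t f g h : f \in Lfun mu 2%:E -> g \in Lfun mu 2%:E ->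
  h \in Lfun mu 2%:E ->
  \int[mu]_x ((t * f x + g x) * h x) =
  t * \int[mu]_x (f x * h x) + \int[mu]_x (g x * h x).
Proof.
move=> fL gL hL; rewrite -RintegralZl//; last exact: integrable_mul_Lfun2.
rewrite -RintegralD//; last exact: integrable_mul_Lfun2.
  by apply: eq_Rintegral => x _; rewrite mulrDl mulrA.
have := integrableZl measurableT t (integrable_mul_Lfun2 fL hL).
by apply: eq_integrable => // x _; rewrite EFinM.
Qed.

Lemma Lfun2_lin t f g : f \in Lfun mu 2%:E -> g \in Lfun mu 2%:E ->
  (fun x => t * f x + g x) \in Lfun mu 2%:E.
Proof.
move=> fL gL; have := (Lfun_submod_closed mu (lee1n 2)).2 t f g fL gL.
by [].
Qed.

Lemma Lfun2_le f g : measurable_fun setT f -> g \in Lfun mu 2%:E ->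
  (forall x, `|f x| <= `|g x|) -> f \in Lfun mu 2%:E.
Proof.
move=> mf /Lfun2P[mg goo] fg; apply/Lfun2P; split=> //.
apply: le_lt_trans goo; apply: ge0_le_integral => //.
- by move=> x _; rewrite lee_fin sqr_ge0.
- by apply/measurable_EFinP; exact: measurable_funX.
- by apply/measurable_EFinP; exact: measurable_funX.
- move=> x _; rewrite lee_fin -[leLHS]ger0_norm ?sqr_ge0//.
  by rewrite -[leRHS]ger0_norm ?sqr_ge0// !normrX lerXn2r ?nnegrE.
Qed.

(** Fatou's lemma for squares: lower semicontinuity under a.e. convergence. It serves both the L2
    norm and the Gagliardo energy. *)
Lemma fatou_sqr (f_ : nat -> T -> R) f (C : \bar R) :
  (forall n, measurable_fun setT (f_ n)) -> measurable_fun setT f ->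
  {ae mu, forall x, f_ n x @[n --> \oo] --> f x} ->
  (forall n, \int[mu]_x (f_ n x ^+ 2)%:E <= C)%E ->
  (\int[mu]_x (f x ^+ 2)%:E <= C)%E.
Proof.
move=> mf_ mf cvf f_C.
have mf2 n : measurable_fun setT (fun x => (f_ n x ^+ 2)%:E).
  by apply/measurable_EFinP; exact: measurable_funX.
rewrite (_ : integral _ _ _ =
    \int[mu]_x limn_einf (fun n => (f_ n x ^+ 2)%:E))%E; last first.
  apply: ae_eq_integral => //.
  - by apply/measurable_EFinP; exact: measurable_funX.
  (* Writing the lower limit as the negative of an upper limit reduces its measurability to that of
     [limn_esup]. *)
  - rewrite (_ : (fun x => _) = fun x =>
        - limn_esup (-%E \o (fun n => (f_ n x ^+ 2)%:E)))%E; last first.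
      by apply/funext => x; rewrite limn_esupN oppeK.
    apply: measurableT_comp => //; apply: measurable_fun_limn_esup => n.
    exact: measurableT_comp.
  - apply: filterS cvf => x cvx _.
    apply/esym; apply: (cvg_limn_einf_sup _).1; apply: cvg_EFin; first exact: nearW.
    by apply: cvgM.
apply: le_trans (@fatou _ _ _ mu _ measurableT _ mf2 _) _.
  by move=> n x _; rewrite lee_fin sqr_ge0.
rewrite limn_einf_lim; apply: lime_le; first exact: is_cvg_einfs.
apply: nearW => n; apply: le_trans (f_C n).
by apply: ereal_inf_lbound; exists n => //=.
Qed.

(** The pointwise half of the Riesz-Fischer theorem; the prescribed rate makes the whole sequence
    converge a.e., without extracting a subsequence. *)
Lemma Lfun2_fast_cauchy_cvg (v_ : nat -> T -> R) (M : R) :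
  (forall n, measurable_fun setT (v_ n)) ->
  (forall n, \int[mu]_x ((v_ n.+1 x - v_ n x) ^+ 2)%:E <= (M * (8 ^+ n)^-1)%:E)%E ->
  exists2 v : T -> R, measurable_fun setT v &
    {ae mu, forall x, v_ n x @[n --> \oo] --> v x}.
Proof.
move=> mv v_le.
(* The weights 4^n make [sum_n 4^n (v_{n+1} - v_n)^2] integrable, and its finiteness
   at a point bounds the increments there by a geometric sequence. *)
pose F n x := (4 ^+ n * (v_ n.+1 x - v_ n x) ^+ 2)%:E.
have F0 n x : (0 <= F n x)%E by rewrite lee_fin mulr_ge0 ?sqr_ge0// exprn_ge0.
have md n : measurable_fun setT (fun x => ((v_ n.+1 x - v_ n x) ^+ 2)%:E).
  by apply/measurable_EFinP/measurable_funX/measurable_funB.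
have mF n : measurable_fun setT (F n).
  rewrite /F; under eq_fun do rewrite EFinM.
  exact: measurable_funeM.
have sumF0 x : (0 <= \sum_(n <oo) F n x)%E by apply: nneseries_ge0.
have sumF_fin : {ae mu, forall x, setT x -> (\sum_(n <oo) F n x \is a fin_num)%E}.
  apply: integrable_ae => //; apply/integrableP; split.
    exact: ge0_emeasurable_sum.
  under eq_integral => x _ do rewrite gee0_abs//.
  rewrite integral_nneseries//.
  have M0 : 0 <= M.
    have := v_le 0%N; rewrite expr0 invr1 mulr1 -lee_fin.
    by apply: le_trans; apply: integral_ge0 => x _; rewrite lee_fin sqr_ge0.
  (* The weighted integrals are at most [M / 2 ^ n], written [2 * M / 2 ^ n.+1] to fit
     [epsilon_trick], which bounds their sum by [2 * M]. *)
  apply: (@le_lt_trans _ _ (0 + (2 * M)%:E)%E); last by rewrite add0e ltry.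
  have : (\sum_(i <oo) (0 + (2 * M / (2 ^ i.+1)%:R)%:E) <=
      \sum_(0 <= i <oo | xpredT i) 0 + (2 * M)%:E :> \bar R)%E.
    by apply: epsilon_trick => //; rewrite mulr_ge0.
  rewrite [X in (_ <= X + _)%E]eseries0//.
  apply: le_trans; apply: lee_nneseries => [n _ _|n _]; first exact: integral_ge0.
  rewrite add0e /F; under eq_integral do rewrite EFinM.
  rewrite ge0_integralZl ?lee_fin ?exprn_ge0//; last first.
    by move=> x _; rewrite lee_fin sqr_ge0.
  apply: (@le_trans _ _ ((4 ^+ n)%:E * (M * (8 ^+ n)^-1)%:E)%E).
    by apply: lee_pmul => //; rewrite ?lee_fin ?exprn_ge0//;
      apply: integral_ge0 => x _; rewrite lee_fin sqr_ge0.
  rewrite -EFinM lee_fin natrX exprS (_ : 8 = 4 * 2 :> R) ?exprMn; last lra.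
  rewrite le_eqVlt; apply/orP; left; apply/eqP; field.
  by rewrite !expf_neq0.
(* An upper limit is defined and measurable everywhere, including the null set where the sequence
   may diverge. *)
exists (fun x => fine (limn_esup (fun n => (v_ n x)%:E))).
  apply: measurableT_comp => //; apply: measurable_fun_limn_esup => n.
  exact/measurable_EFinP.
apply: filterS sumF_fin => x /(_ I) sumF.
suff /cvg_ex[/= l vl] : cvgn (v_ ^~ x).
  rewrite (_ : limn_esup _ = l%:E)//.
  by apply: (cvg_limn_einf_sup _).2; apply: cvg_EFin; first exact: nearW.
set k := fine (\sum_(n <oo) F n x)%E.
have k0 : 0 <= k by exact: fine_ge0.
have dk n : `|v_ n.+1 x - v_ n x| <= geometric (Num.sqrt k) 2^-1 n.
  have : 4 ^+ n * (v_ n.+1 x - v_ n x) ^+ 2 <= k.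
    rewrite -lee_fin /k fineK// -/(F n x).
    apply: (le_trans _ (nneseries_lim_ge n.+1 (fun m _ _ => F0 m x))).
    by rewrite big_nat_recr//= leeDr//; apply: sume_ge0.
  rewrite -(@ler_sqrt _ _ k)// (_ : _ * _ = (2 ^+ n * (v_ n.+1 x - v_ n x)) ^+ 2).
    rewrite sqrtr_sqr normrM ger0_norm ?exprn_ge0// /= exprVn.
    by rewrite ler_pdivlMr ?exprn_gt0// mulrC.
  by rewrite exprMn -exprM mulnC exprM; congr (_ ^+ _ * _); lra.
have cvs : cvgn (series (telescope (v_ ^~ x))).
  apply: normed_cvg; apply: series_le_cvg dk _ => [n|n|] //=.
  by apply: is_cvg_geometric_series; rewrite ger0_norm; lra.
rewrite (_ : v_ ^~ x = fun n => v_ 0%N x + series (telescope (v_ ^~ x)) n).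
  by apply: is_cvgD => //; exact: is_cvg_cst.
by apply/funext => n; exact: eq_sum_telescope.
Qed.

End square_integrable.

(** * Null sets in product spaces *)

Section ae_product.
Context d1 d2 (T1 : measurableType d1) (T2 : measurableType d2) (R : realType).
Variables (m1 : {measure set T1 -> \bar R})
          (m2 : {sigma_finite_measure set T2 -> \bar R}).
Local Notation m12 := (m1 \x m2)%E.

(** The cylinder over a null set is null even if the other factor has infinite measure, because
    [0 * +oo = 0]. *)
Lemma ae_fst (P : T1 -> Prop) :
  {ae m1, forall x, P x} -> {ae m12, forall z, P z.1}.
Proof.
move=> [N [mN N0 NP]]; exists (N `*` setT); split.
- exact: measurableX.
- transitivity (m1 N * m2 setT)%E; first exact: product_measure1E.
  by rewrite N0 mul0e.
- by move=> z nP; split => //; apply: NP.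
Qed.

Lemma ae_snd (P : T2 -> Prop) :
  {ae m2, forall x, P x} -> {ae m12, forall z, P z.2}.
Proof.
move=> [N [mN N0 NP]]; exists (setT `*` N); split.
- exact: measurableX.
- transitivity (m1 setT * m2 N)%E; first exact: product_measure1E.
  by rewrite N0 mule0.
- by move=> z nP; split => //; apply: NP.
Qed.

End ae_product.

(** * The normalizing constant and measurability in R^d *)

Section gamma_positive.
Context {R : realType}.
Implicit Types z t : R.
Local Notation leb := (@lebesgue_measure R).

Let integrand z t := t `^ (z - 1) * expR (- t).

Let measurable_integrand z D : measurable_fun D (EFin \o integrand z).
Proof.
apply/measurable_EFinP; apply: measurable_funS (@measurableT _ R) _ _ => //.
apply: measurable_funM; first exact: measurable_powR.
by apply: measurableT_comp => //; exact: measurableT_comp.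
Qed.

Let integrand_ge0 z t : 0 <= integrand z t.
Proof. by rewrite mulr_ge0 ?powR_ge0 ?expR_ge0. Qed.

Let integral_near0 z : 0 < z ->
  (\int[leb]_(t in `]0%R, 1%R]) (integrand z t)%:E <= (z^-1)%:E)%E.
Proof.
(* For [z < 1] the integrand is singular at 0, so the interval is exhausted by [[1 / (n + 2), 1]],
   where [expR (- t) <= 1] and the antiderivative [t ^ z / z] apply. The shift by 2 keeps the left
   end strictly below 1. *)
move=> z0; pose F n := [set` `[(n.+2%:R : R)^-1, 1]].
have inv_gt0 n : 0 < (n.+2%:R : R)^-1 by rewrite invr_gt0.
have -> : [set` `](0 : R), 1]] = \bigcup_n F n.
  apply/seteqP; split=> t /=; last first.
    by move=> [n _]; rewrite /F /= !in_itv/= => /andP[nt ->];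
      rewrite (lt_le_trans _ nt).
  rewrite in_itv/= => /andP[t0 t1].
  exists (Num.truncn t^-1) => //; rewrite /F /= in_itv/= t1 andbT.
  rewrite invf_ple ?posrE// (le_trans (ltW (truncnS_gt _)))// ler_nat.
  exact: leqnSn.
have mF n : measurable (F n) by exact: measurable_itv.
have cv : (\int[leb]_(t in F i) (integrand z t)%:E @[i --> \oo] -->
    \int[leb]_(t in \bigcup_n F n) (integrand z t)%:E)%E.
  apply: ge0_nondecreasing_set_cvg_integral => //.
  - move=> n m nm; apply/subsetPset; apply: subset_itvr.
    by rewrite bnd_simp lef_pV2 ?posrE// ler_nat.
  - by move=> n; exact: measurable_integrand.
  - by move=> n t _; rewrite lee_fin.
rewrite -(cvg_lim _ cv)//; apply: lime_le; first by apply/cvg_ex; eexists; exact: cv.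
apply: nearW => n; rewrite /F.
have n1 : (n.+2%:R : R)^-1 < 1 by rewrite invf_lt1// ltr1n.
have dG (t : R) : 0 < t -> is_derive t 1 (fun t => z^-1 * t `^ z) (t `^ (z - 1)).
  move=> t0; have := is_derive1_powR z t0 => d.
  rewrite [X in is_derive _ _ _ X](_ : _ = z^-1 * (z * t `^ (z - 1))).
    exact: (is_deriveZ z^-1 d).
  by rewrite mulrA mulVf ?gt_eqF// mul1r.
have dP (t : R) : 0 < t -> derivable (@powR R ^~ (z - 1)) t 1.
  by move=> t0; apply: derivable_powR; rewrite in_itv/= t0.
apply: (@le_trans _ _
    (\int[leb]_(t in `[((n.+2%:R : R)^-1)%R, 1%R]) (t `^ (z - 1))%:E)%E).
  apply: ge0_le_integral => //.
  - by move=> t _; rewrite lee_fin.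
  - exact: measurable_integrand.
  - apply/measurable_EFinP; apply: measurable_funS (@measurableT _ R) _ _ => //.
  - move=> t; rewrite /= in_itv/= => /andP[nt _]; rewrite lee_fin ler_piMr ?powR_ge0//.
    by rewrite -expR0 ler_expR oppr_le0 (le_trans _ nt)// ltW.
rewrite (@continuous_FTC2 _ _ (fun t => z^-1 * t `^ z))//.
- by rewrite powR1 mulr1 -EFinB lee_fin lerBlDr lerDl mulr_ge0 ?powR_ge0// invr_ge0 ltW.
- apply: derivable_within_continuous => t; rewrite in_itv/= => /andP[nt _].
  by apply: dP; rewrite (lt_le_trans _ nt).
- have cG (t : R) : 0 < t -> {for t, continuous (fun t => z^-1 * t `^ z)}.
    by move=> t0; apply: differentiable_continuous; apply/derivable1_diffP;
      case: (dG t t0).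
  split.
  + move=> t; rewrite in_itv/= => /andP[nt _].
    by case: (dG t (lt_trans (inv_gt0 _) nt)).
  + by apply: cvg_at_right_filter; exact: cG.
  + by apply: cvg_at_left_filter; exact: cG.
- move=> t; rewrite in_itv/= => /andP[nt _]; rewrite derive1E.
  by case: (dG t (lt_trans (inv_gt0 _) nt)).
Qed.

Let integral_near_oo z :
  (\int[leb]_(t in `]1%R, +oo[) (integrand z t)%:E < +oo)%E.
Proof.
(* From [ln t <= t / k - 1 + ln k], this [k] makes [|z - 1| * t / k] at most [t / 2], leaving a
   decay [expR (- t / 2)]. The factor 2 in [C] cancels the 1/2 in the exponential density. *)
pose k := 2 * `|z - 1| + 1.
have k0 : 0 < k by rewrite /k; have := normr_ge0 (z - 1); lra.
pose C := 2 * expR (`|z - 1| * `|ln k|).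
have bound t : 1 <= t -> integrand z t <= C * exponential_pdf 2^-1 t.
  move=> t1; have t0 : 0 < t by lra.
  rewrite exponential_pdfE ?(ltW t0)// /C.
  rewrite [X in _ <= X](_ : _ = expR (`|z - 1| * `|ln k| + - 2^-1 * t)); last first.
    by rewrite expRD; field.
  rewrite /integrand /powR gt_eqF// -expRD ler_expR.
  have lnt : ln t <= t / k - 1 + ln k.
    have -> : ln t = ln (t / k) + ln k.
      by rewrite lnM ?posrE ?invr_gt0// lnV ?posrE// subrK.
    rewrite lerD2r; have := @le_ln1Dx R (t / k - 1).
    by rewrite (_ : 1 + (t / k - 1) = t / k); [apply; rewrite ltrBrDl subrr divr_gt0|lra].
  have ln0 : 0 <= ln t by rewrite ln_ge0.
  have l1 : (z - 1) * ln t <= `|z - 1| * ln t by rewrite ler_wpM2r// ler_norm.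
  have l2 : `|z - 1| * ln t <= `|z - 1| * (t / k + `|ln k|).
    by rewrite ler_wpM2l//; have := ler_norm (ln k); lra.
  have l3 : `|z - 1| * (t / k) <= t / 2.
    rewrite mulrA ler_pdivrMr// mulrAC ler_pdivlMr//.
    rewrite /k; nra.
  by move: l2; rewrite mulrDr; lra.
apply: (@le_lt_trans _ _ (\int[leb]_t (C%:E * (exponential_pdf 2^-1 t)%:E))%E).
  have mpdf D : measurable_fun D (fun t : R => (C%:E * (exponential_pdf 2^-1 t)%:E)%E).
    apply: measurable_funS (@measurableT _ R) _ _ => //.
    apply: measurable_funeM; apply/measurable_EFinP.
    exact: measurable_exponential_pdf.
  have C0 : 0 <= C by rewrite mulr_ge0 ?expR_ge0.
  have g0 t : (0 <= C%:E * (exponential_pdf 2^-1 t)%:E)%E.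
    by rewrite mule_ge0 ?lee_fin// exponential_pdf_ge0.
  apply: (@le_trans _ _ (\int[leb]_(t in `]1%R, +oo[)
      (C%:E * (exponential_pdf 2^-1 t)%:E))%E).
    apply: ge0_le_integral => //; first by move=> t _; rewrite lee_fin.
    + exact: measurable_integrand.
    + exact: mpdf.
    move=> t; rewrite /= in_itv/= andbT => /ltW t1.
    by rewrite -EFinM lee_fin bound.
  by apply: ge0_subset_integral => //; exact: mpdf.
rewrite ge0_integralZl//.
- by rewrite integral_exponential_pdf// mule1 ltry.
- by apply/measurable_EFinP; exact: measurable_exponential_pdf.
- by move=> t _; rewrite lee_fin exponential_pdf_ge0.
- by rewrite lee_fin mulr_ge0 ?expR_ge0.
Qed.

(** Finiteness is part of the claim, since [fine] sends [+oo] to 0. The integral does not vanish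
    because the integrand is positive on []0, 1[], a set of measure 1. *)
Lemma euler_gamma_gt0 z : 0 < z -> 0 < euler_gamma z.
Proof.
move=> z0; rewrite /euler_gamma /Rintegral -/(integrand z).
have I0 : (0 <= \int[leb]_(t in `]0%R, +oo[) (integrand z t)%:E)%E.
  by apply: integral_ge0 => t _; rewrite lee_fin.
apply: fine_gt0; apply/andP; split; last first.
  rewrite (@itv_bndbnd_setU _ _ _ (BRight 1))//; last by rewrite bnd_simp.
  rewrite ge0_integral_setU//=.
  - apply: lte_add_pinfty; last exact: integral_near_oo.
    exact: le_lt_trans (integral_near0 z0) (ltry _).
  - exact: measurable_integrand.
  - by move=> t _; rewrite lee_fin; exact: integrand_ge0.
  - apply/disj_setPS => t [/=]; rewrite !in_itv/= => /andP[_ t1] /andP[t1'].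
    by move: t1; rewrite leNgt t1'.
rewrite lt_def I0 andbT; apply/eqP => I_eq0.
have /(ae_eq_integral_abs leb (measurable_itv _) (@measurable_integrand z _)) :
    (\int[leb]_(t in `]0%R, +oo[) `|(integrand z t)%:E| = 0)%E.
  by rewrite -[RHS]I_eq0; apply: eq_integral => t _; rewrite gee0_abs// lee_fin.
move=> [N [mN N0 sN]].
have : (leb [set` `]0%R, 1%R[] <= leb N)%E.
  apply: le_measure; rewrite ?inE// => t /=; rewrite in_itv/= => /andP[t0 t1].
  apply: sN => /= f0; have := f0; rewrite in_itv/= t0 => /(_ isT) [].
  by apply/eqP; rewrite gt_eqF// mulr_gt0 ?powR_gt0 ?expR_gt0.
by rewrite N0 lebesgue_measure_itv/= lte_fin ltr01 -EFinB lee_fin subr0 ler10.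
Qed.

(** As [0 < alpha / 2 < 1], one step of the recursion gives [Gamma (- (alpha / 2))] as
    [euler_gamma (1 - alpha / 2)] over [- (alpha / 2)], which is nonzero. *)
Lemma Cda_gt0 n alpha : 0 < alpha -> alpha < 2 -> 0 < @Cda R n alpha.
Proof.
move=> a0 a2.
have Gp : 0 < Gamma (alpha / 2 + n%:R / 2).
  have z0 : 0 < alpha / 2 + n%:R / 2 by rewrite ltr_wpDr ?divr_ge0// divr_gt0.
  by rewrite /Gamma z0 big_ord0 addr0 divr1 euler_gamma_gt0.
have Gn : Gamma (- (alpha / 2)) != 0.
  rewrite /Gamma ltNge oppr_le0 divr_ge0 ?ltW//= opprK.
  have -> : Num.truncn (alpha / 2) = 0%N.
    by apply/truncn0Pn; rewrite -ltNge; lra.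
  rewrite big_ord1 addr0 mulf_neq0//.
    by rewrite gt_eqF// euler_gamma_gt0// mulr1n; lra.
  by rewrite invr_eq0 oppr_eq0 gt_eqF// divr_gt0.
apply: divr_gt0; apply: mulr_gt0 => //; rewrite ?normr_gt0//.
exact/powR_gt0/pi_gt0.
Qed.

End gamma_positive.

(** * Open sets and the Euclidean norm for the coordinate sigma-algebra *)

Section measurable_row.
Context {R : realType} {n : nat}.
Implicit Types A : set 'rV[R]_n.

Lemma measurable_row_box (D : 'I_n -> set R) : (forall i, measurable (D i)) ->
  measurable [set x : 'rV[R]_n | forall i, D i (x ord0 i)].
Proof.
move=> mD; rewrite (_ : [set x | _] = \bigcap_(i in [set: 'I_n])
    ((fun x : 'rV[R]_n => x ord0 i) @^-1` D i)).
  apply: fin_bigcap_measurable => // i _.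
  by rewrite -[X in measurable X]setTI; exact: measurable_coord_rV.
by apply/seteqP; split => x /= Dx i; [move=> _|]; exact: Dx.
Qed.

(** An open set is the union of the countably many boxes inside it with rational centre and
    half-width [1 / (k + 1)]; the other boxes are replaced by the empty set. *)
Lemma open_measurable_row A : open A -> measurable A.
Proof.
move=> oA; pose box (qk : 'rV[rat]_n * nat) := [set x : 'rV[R]_n |
  forall i, x ord0 i \in `](ratr (qk.1 ord0 i) - qk.2.+1%:R^-1),
                           (ratr (qk.1 ord0 i) + qk.2.+1%:R^-1)[].
pose F qk := if `[< box qk `<=` A >] then box qk else set0.
have -> : A = \bigcup_qk F qk.
  apply/seteqP; split=> [x Ax|x [qk _]]; last first.
    by rewrite /F; case: asboolP => // + bx; apply.
  have /nbhs_ballP[e /= e0 eA] : nbhs x A by exact: open_nbhs_nbhs.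
  (* The half-width is below [e / 2], so a box whose centre is that close to [x] stays within
     distance [e] of [x]. *)
  pose k := Num.truncn (2 / e).
  have [h hE [h0 he]] : exists2 h : R, h = k.+1%:R^-1 & 0 < h /\ h < e / 2.
    exists k.+1%:R^-1 => //; rewrite invr_gt0 ltr0n; split=> //.
    by rewrite invf_plt ?posrE ?divr_gt0// invf_div; exact: truncnS_gt.
  have /choice[q qP] (i : 'I_n) : exists q : rat,
      ratr q \in `](x ord0 i - h), (x ord0 i + h)[.
    by apply: rat_in_itvoo; lra.
  exists (\row_i q i, k) => //; rewrite /F asboolT.
    move=> i; rewrite /= mxE -hE; have := qP i; rewrite !in_itv/= => /andP[? ?].
    by apply/andP; split; lra.
  move=> y /= by_; apply: eA; rewrite /ball/= /mx_ball; split=> // i j.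
  rewrite (ord1 i); have := qP j; have := by_ j; rewrite /= mxE -hE !in_itv/=.
  rewrite /ball/= => /andP[? ?] /andP[? ?].
  by rewrite ltr_norml; apply/andP; split; lra.
apply: countable_bigcupT_measurable; first exact: countableP.
move=> qk; rewrite /F; case: asboolP => // _.
apply: (@measurable_row_box (fun i => [set` `](ratr (qk.1 ord0 i) -
  qk.2.+1%:R^-1), (ratr (qk.1 ord0 i) + qk.2.+1%:R^-1)[])) => i.
exact: measurable_itv.
Qed.

Lemma measurable_enorm : measurable_fun setT (@enorm R n).
Proof.
rewrite /enorm; apply: measurableT_comp.
  by apply: continuous_measurable_fun; exact: sqrt_continuous.
apply: measurable_sum => i; apply: measurable_funX.
exact: measurable_coord_rV.
Qed.

End measurable_row.

(** * The Gagliardo form and the fractional Poisson problem *)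

Section gagliardo.
Context {R : realType} {d : nat}.
Variables (alpha : R).
Implicit Types (u v w : 'rV[R]_d -> R) (O : set 'rV[R]_d).
Local Notation leb := (@lebesgue_rV R d).
Local Notation leb2 := (leb \x leb)%E.

(** The square root of the weight turns the Gagliardo form into an L2 inner product on the product
    space, so the results on square-integrable functions apply to it. *)
Definition gdiff v (z : 'rV[R]_d * 'rV[R]_d) : R :=
  (v z.1 - v z.2) / Num.sqrt (gagliardo_weight alpha z).

Lemma gdiffM u v z : gdiff u z * gdiff v z =
  (u z.1 - u z.2) * (v z.1 - v z.2) / gagliardo_weight alpha z.
Proof.
rewrite /gdiff mulrACA -invfM -expr2 sqr_sqrtr//.
by rewrite /gagliardo_weight powR_ge0.
Qed.

Lemma gdiff_lin t u v z :
  gdiff (fun x => t * u x + v x) z = t * gdiff u z + gdiff v z.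
Proof. by rewrite /gdiff; ring. Qed.

Lemma measurable_gdiff v : measurable_fun setT v -> measurable_fun setT (gdiff v).
Proof.
move=> mv; apply: measurable_funM.
  by apply: measurable_funB; apply: measurableT_comp.
rewrite (_ : (fun z => _) = fun z : 'rV[R]_d * 'rV[R]_d =>
    enorm (z.1 - z.2) `^ (- ((d%:R + alpha) / 2))).
  apply: (measurableT_comp (measurable_powR _)).
  apply: (measurableT_comp measurable_enorm).
  apply/measurable_fun_rVP => i; under eq_fun do rewrite !mxE.
  by apply: measurable_funB; apply: (measurableT_comp (measurable_coord_rV i)).
apply/funext => z; rewrite /gagliardo_weight -powR12_sqrt ?powR_ge0//.
by rewrite -powRrM powRN.
Qed.

Lemma HsP v : Hs alpha v <-> v \in Lfun leb 2%:E /\ gdiff v \in Lfun leb2 2%:E.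
Proof.
have E : (\int[leb2]_z ((v z.1 - v z.2) ^+ 2 / gagliardo_weight alpha z)%:E =
    \int[leb2]_z (gdiff v z ^+ 2)%:E)%E.
  by apply: eq_integral => z _; rewrite [in RHS]expr2 gdiffM -expr2.
split=> [[vL voo]|[vL /Lfun2P[_ voo]]]; split=> //; last by rewrite E.
apply/Lfun2P; split; last by rewrite -E.
exact: (measurable_gdiff (measurable_Lfun2 vL)).
Qed.

Lemma bilinE u v : bilin alpha u v =
  @Cda R d alpha / 2 * \int[leb2]_z (gdiff u z * gdiff v z).
Proof.
by rewrite /bilin; congr (_ * _); apply: eq_Rintegral => z _; rewrite gdiffM.
Qed.

Lemma bilin_sym u v : bilin alpha u v = bilin alpha v u.
Proof.
by rewrite !bilinE; congr (_ * _); apply: eq_Rintegral => z _; rewrite mulrC.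
Qed.

Lemma bilin_lin t u v w : Hs alpha u -> Hs alpha v -> Hs alpha w ->
  bilin alpha (fun x => t * u x + v x) w =
  t * bilin alpha u w + bilin alpha v w.
Proof.
move=> /HsP[_ uL] /HsP[_ vL] /HsP[_ wL]; rewrite !bilinE.
under eq_Rintegral do rewrite gdiff_lin.
by rewrite Rintegral_mul_lin//; ring.
Qed.

Lemma Hs_lin t u v : Hs alpha u -> Hs alpha v -> Hs alpha (fun x => t * u x + v x).
Proof.
move=> /HsP[uL guL] /HsP[vL gvL]; apply/HsP; split; first exact: Lfun2_lin.
rewrite (_ : gdiff _ = fun z => t * gdiff u z + gdiff v z).
  exact: Lfun2_lin.
by apply/funext => z; exact: gdiff_lin.
Qed.

Lemma Htilde_lin O t u v : Htilde O alpha u -> Htilde O alpha v ->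
  Htilde O alpha (fun x => t * u x + v x).
Proof.
move=> [uH u0] [vH v0]; split; first exact: Hs_lin.
by apply: filterS2 u0 v0 => x u0 v0 Ox; rewrite u0// v0// mulr0 addr0.
Qed.

Lemma Htilde0 O : Htilde O alpha (fun=> 0).
Proof.
split; last exact: aeW.
have L0 d' (T : measurableType d') (mu : {measure set T -> \bar R}) :
    (fun=> 0 : R) \in Lfun mu 2%:E.
  by apply/Lfun2P; split=> //; under eq_integral do rewrite expr0n/=;
    rewrite integral0 ltry.
apply/HsP; split; first exact: L0.
rewrite (_ : gdiff _ = fun=> 0) ?L0//.
by apply/funext => z; rewrite /gdiff subrr mul0r.
Qed.

End gagliardo.

(** * The fractional Poincare inequality *)

Section poincare.
Context {R : realType} {d : nat}.
Variables (O : set 'rV[R]_d) (alpha : R).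
Hypotheses (d_gt0 : (0 < d)%N) (alpha_gt0 : 0 < alpha) (O_bnd : bounded_set O).
Local Notation leb := (@lebesgue_rV R d).
Local Notation leb2 := (leb \x leb)%E.
Local Notation gdiff := (gdiff alpha).

Lemma closure_bounded_coord :
  exists2 M : R, 0 <= M & forall x, closure O x -> forall i, `|x ord0 i| <= M.
Proof.
have [M [_ MO]] := O_bnd.
(* One unit exceeds the bound of [bounded_set] strictly; the other pays for moving from the closure
   to a point of [O]. *)
exists (`|M| + 2) => [|x Ox i]; first by rewrite addr_ge0.
have [y [Oy xy]] : O `&` ball x 1 !=set0.
  by apply: Ox; apply: nbhsx_ballx.
have yM : `|y| <= `|M| + 1.
  by apply: MO => //; have := ler_norm M; lra.
have yi : `|y ord0 i| <= `|y|.
  rewrite -[leRHS]/(mx_norm y) mx_normrE.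
  exact: (le_bigmax _ (fun ij : 'I_1 * 'I_d => `|y ij.1 ij.2|) (ord0, i)).
have := xy.2 ord0 i; rewrite /ball/= => xyi.
have := ler_normD (x ord0 i - y ord0 i) (y ord0 i); rewrite subrK; lra.
Qed.

(* Integrate [v x ^ 2 = (v x - v w) ^ 2], for [x] in [O] and [w] in a box of volume 1
   away from [O]; [K] bounds the weight on such pairs. *)
Lemma poincare : exists2 K : R, 0 < K & forall v, Htilde O alpha v ->
  (\int[leb]_x (v x ^+ 2)%:E <= K%:E * \int[leb2]_z (gdiff v z ^+ 2)%:E)%E.
Proof.
have [M M0 OM] := closure_bounded_coord.
(* Each coordinate of a point of [E] differs from that of a point of [closure O] by at least 1 and
   at most [2 * M + 2], which bounds the weight on both sides. *)
pose E := [set w : 'rV[R]_d | forall i, w ord0 i \in `[M + 1, M + 2]].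
have mE : measurable E.
  apply: (@measurable_row_box _ _ (fun=> [set` `[M + 1, M + 2]])) => i.
  exact: measurable_itv.
have E1 : leb E = 1%E.
  rewrite (@lebesgue_rV_box R d (fun=> [set` `[M + 1, M + 2]])) => [|i].
    rewrite big1// => i _; rewrite lebesgue_measure_itv/= lte_fin ifT; last lra.
    by rewrite -EFinB; congr (_%:E); lra.
  exact: measurable_itv.
pose L := Num.sqrt (d%:R * (2 * M + 2) ^+ 2).
pose K := L `^ (d%:R + alpha).
have L0 : 0 < L.
  by rewrite sqrtr_gt0 mulr_gt0 ?ltr0n// exprn_gt0//; lra.
have K0 : 0 < K by exact: powR_gt0.
have dist_le (x w : 'rV[R]_d) i : closure O x -> E w ->
    1 <= (x ord0 i - w ord0 i) ^+ 2 <= (2 * M + 2) ^+ 2.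
  move=> /OM /(_ i) + /(_ i); rewrite ler_norml in_itv/= => /andP[? ?] /andP[? ?].
  by apply/andP; split; nra.
have s0 : 0 < d%:R + alpha by rewrite ltr_wpDl.
have weight_le z : closure O z.1 -> E z.2 -> 0 < gagliardo_weight alpha z <= K.
  move=> Oz Ez; apply/andP; split.
    apply: powR_gt0; rewrite sqrtr_gt0.
    rewrite (bigD1 (Ordinal d_gt0))//= ltr_pwDl//; last first.
      by apply: sumr_ge0 => i _; exact: sqr_ge0.
    by rewrite !mxE; have /andP[+ _] := dist_le _ _ (Ordinal d_gt0) Oz Ez; lra.
  rewrite ge0_ler_powR ?nnegrE ?sqrtr_ge0 ?(ltW s0)//.
  rewrite /enorm ler_sqrt; last by rewrite mulr_ge0// sqr_ge0.
  apply: (@le_trans _ _ (\sum_(i < d) (2 * M + 2) ^+ 2)); last first.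
    by rewrite sumr_const card_ord [leRHS]mulr_natl.
  apply: ler_sum => i _; rewrite !mxE.
  by have /andP[] := dist_le _ _ i Oz Ez.
exists K => // v [/HsP[vL /Lfun2P[mgv _]] v0].
have mv := measurable_Lfun2 vL.
(* Since [E] has measure 1, Tonelli's theorem gives [F] the integral of [v ^ 2]. *)
pose F (z : 'rV[R]_d * 'rV[R]_d) := ((v z.1 ^+ 2)%:E * (\1_E z.2)%:E)%E.
have mF : measurable_fun setT F.
  apply: emeasurable_funM; apply/measurable_EFinP.
    apply: measurable_funX; exact: measurableT_comp.
  by apply: measurableT_comp => //; exact: measurable_indic.
have F0 z : (0 <= F z)%E by rewrite mule_ge0 ?lee_fin ?sqr_ge0.
have -> : (\int[leb]_x (v x ^+ 2)%:E = \int[leb2]_z F z)%E.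
  rewrite fubini_tonelli1//; apply: eq_integral => x _.
  rewrite /fubini_F /F/= ge0_integralZl ?lee_fin ?sqr_ge0//.
  - by rewrite integral_indic// setIT; apply/esym; rewrite [X in (_ * X)%E]E1 mule1.
  - by apply/measurable_EFinP; exact: measurable_indic.
rewrite -ge0_integralZl ?lee_fin ?(ltW K0)//; last 2 first.
- by apply/measurable_EFinP; exact: measurable_funX.
- by move=> z _; rewrite lee_fin sqr_ge0.
apply: ae_ge0_le_integral => //.
- by move=> z _; rewrite mule_ge0 ?lee_fin ?sqr_ge0 ?(ltW K0).
- by apply: measurable_funeM; apply/measurable_EFinP; exact: measurable_funX.
have v01 : {ae leb2, forall z, ~ closure O z.1 -> v z.1 = 0}.
  exact: (ae_fst _ v0).
have v02 : {ae leb2, forall z, ~ closure O z.2 -> v z.2 = 0}.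
  exact: (ae_snd _ v0).
apply: filterS2 v01 v02 => z v0z1 v0z2 _.
have rhs0 : (0 <= K%:E * (gdiff v z ^+ 2)%:E)%E.
  by rewrite mule_ge0 ?lee_fin ?sqr_ge0 ?(ltW K0).
have [Oz|/v0z1 vz1] := pselect (closure O z.1); last first.
  by rewrite /F vz1 expr0n/= mul0e.
have [Ez|Ez] := pselect (E z.2); last by rewrite /F indicE memNset// mule0.
(* [E] misses [closure O]: a common point would be at coordinate distance at least 1 from itself. *)
have vz2 : v z.2 = 0.
  apply: v0z2 => Oz2; have := dist_le _ _ (Ordinal d_gt0) Oz2 Ez.
  by rewrite subrr expr0n/= => /andP[]; lra.
have /andP[w0 wK] := weight_le z Oz Ez.
rewrite /F indicE mem_set// mule1 -EFinM lee_fin [in leRHS]expr2 gdiffM vz2 subr0.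
rewrite -expr2 mulrCA ler_peMr ?sqr_ge0//.
by rewrite ler_pdivlMr// mul1r.
Qed.

End poincare.

(** * The inner product on the domain via extension by zero *)

Section restriction.
Context {R : realType} {d : nat}.
Variable O : set 'rV[R]_d.
Hypothesis mO : measurable O.
Local Notation leb := (@lebesgue_rV R d).
Implicit Types u v g : 'rV[R]_d -> R.

Lemma L2dotE g v : L2dot O g v = \int[leb]_x ((g \_ O) x * (v \_ O) x).
Proof.
rewrite /L2dot Rintegral_mkcond; apply: eq_Rintegral => x _.
by rewrite !patchE; case: ifP; rewrite ?mulr0.
Qed.

Lemma L2_Lfun v : v \in Lfun leb 2%:E -> L2 O v.
Proof.
move=> vL; apply: (Lfun2_le _ vL); last first.
  by move=> x; rewrite patchE; case: ifP; rewrite ?normr0.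
by apply/(measurable_restrictT _ _).1 => //; apply: measurable_funS (measurable_Lfun2 vL).
Qed.

Lemma restrict_lin t u v : (fun x => t * u x + v x) \_ O =
  (fun x => t * (u \_ O) x + (v \_ O) x).
Proof.
by apply/funext => x; rewrite !patchE; case: ifP; rewrite ?mulr0 ?addr0.
Qed.

Lemma L2_lin t u v : L2 O u -> L2 O v -> L2 O (fun x => t * u x + v x).
Proof. by move=> uL vL; rewrite /L2/= restrict_lin; exact: Lfun2_lin. Qed.

Lemma L2dot_sym u v : L2dot O u v = L2dot O v u.
Proof. by apply: eq_Rintegral => x _; rewrite mulrC. Qed.

Lemma L2dot_linl t u v g : L2 O u -> L2 O v -> L2 O g ->
  L2dot O (fun x => t * u x + v x) g = t * L2dot O u g + L2dot O v g.
Proof.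
by move=> uL vL gL; rewrite !L2dotE restrict_lin Rintegral_mul_lin.
Qed.

Lemma L2dot_linr t u v g : L2 O u -> L2 O v -> L2 O g ->
  L2dot O g (fun x => t * u x + v x) = t * L2dot O g u + L2dot O g v.
Proof. by move=> uL vL gL; rewrite L2dot_sym L2dot_linl// !(L2dot_sym _ g). Qed.

Lemma L2dot_sqr_lin t u v : L2 O u -> L2 O v ->
  L2dot O (fun x => t * u x + v x) (fun x => t * u x + v x) =
  t ^+ 2 * L2dot O u u + 2 * t * L2dot O u v + L2dot O v v.
Proof.
move=> uL vL; have wL := L2_lin t uL vL.
by rewrite L2dot_linl// !L2dot_linr// (L2dot_sym v u); ring.
Qed.

Lemma L2dot_ge0 u : 0 <= L2dot O u u.
Proof. by apply: Rintegral_ge0 => x _; rewrite -expr2 sqr_ge0. Qed.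

Lemma L2dot_le_integral v (C : R) : v \in Lfun leb 2%:E ->
  (\int[leb]_x (v x ^+ 2)%:E <= C%:E)%E -> L2dot O v v <= C.
Proof.
move=> vL vC; rewrite L2dotE.
apply: (@le_trans _ _ (\int[leb]_x (v x * v x))).
  apply: le_Rintegral => //.
  - by apply: integrable_mul_Lfun2; exact: L2_Lfun.
  - exact: integrable_mul_Lfun2.
  - by move=> x _; rewrite patchE; case: ifP; rewrite ?mulr0 // -expr2 sqr_ge0.
rewrite -lee_fin /Rintegral; under eq_integral do rewrite -expr2.
rewrite fineK// ge0_fin_numE; first exact: le_lt_trans vC (ltry _).
by apply: integral_ge0 => x _; rewrite lee_fin sqr_ge0.
Qed.

End restriction.

(** * Well-posedness of the fractional Poisson problem *)

Section weak_solution_existence.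
Context {R : realType} {d : nat}.
Variables (O : set 'rV[R]_d) (alpha : R).
Hypotheses (d_gt0 : (0 < d)%N) (alpha_gt0 : 0 < alpha) (alpha_lt2 : alpha < 2).
Hypotheses (O_open : open O) (O_bnd : bounded_set O).
Local Notation leb := (@lebesgue_rV R d).
Local Notation leb2 := (leb \x leb)%E.
Local Notation gdiff := (gdiff alpha).
Local Notation Htilde := (Htilde O alpha).
Local Notation bilin := (bilin alpha).
Implicit Types u v w g : 'rV[R]_d -> R.

Let c : R := @Cda R d alpha / 2.

Let c_gt0 : 0 < c.
Proof. by apply: divr_gt0 => //; exact: Cda_gt0. Qed.

Lemma bilin_sqr v : Hs alpha v ->
  (\int[leb2]_z (gdiff v z ^+ 2)%:E = (c^-1 * bilin v v)%:E)%E.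
Proof.
move=> /HsP[_ /Lfun2P[_ voo]]; rewrite bilinE mulKf ?gt_eqF//.
rewrite /Rintegral; under [in RHS]eq_integral do rewrite -expr2.
rewrite fineK// ge0_fin_numE//; apply: integral_ge0 => z _.
by rewrite lee_fin sqr_ge0.
Qed.

Lemma bilin_ge0 v : 0 <= bilin v v.
Proof.
rewrite bilinE mulr_ge0 ?(ltW c_gt0)// Rintegral_ge0// => z _.
by rewrite -expr2 sqr_ge0.
Qed.

(** Coercivity: the Poincare inequality in terms of [bilin], with the positive normalizing constant
    absorbed into [P]. *)
Lemma Htilde_sqr_le : exists2 P : R, 0 < P & forall v, Htilde v ->
  (\int[leb]_x (v x ^+ 2)%:E <= (P * bilin v v)%:E)%E.
Proof.
have [K K0 KP] := poincare d_gt0 alpha_gt0 O_bnd.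
exists (K * c^-1) => [|v vH]; first by rewrite mulr_gt0 ?invr_gt0.
by have := KP v vH; rewrite (bilin_sqr vH.1) -EFinM mulrA.
Qed.

(** By coercivity an energy-Cauchy sequence is also L2-Cauchy, hence converges a.e.; Fatou's lemma
    then carries both Cauchy bounds over to the limit. *)
Lemma Htilde_complete (v_ : nat -> 'rV[R]_d -> R) (M : R) :
  (forall n, Htilde (v_ n)) ->
  (forall n m, (n <= m)%N ->
    bilin (v_ m \- v_ n) (v_ m \- v_ n) <= M * (8 ^+ n)^-1) ->
  exists2 v, Htilde v &
    forall n, bilin (v_ n \- v) (v_ n \- v) <= M * (8 ^+ n)^-1.
Proof.
move=> v_H v_cauchy; have [P P0 PP] := Htilde_sqr_le.
have subE u v : u \- v = (fun x => -1 * v x + u x).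
  by apply/funext => x /=; rewrite mulN1r addrC.
have subH u v : Htilde u -> Htilde v -> Htilde (u \- v).
  by move=> uH vH; rewrite subE; exact: Htilde_lin.
have mv_ n : measurable_fun setT (v_ n).
  by have [[vL _] _] := v_H n; exact: measurable_Lfun2 vL.
have sqr_le n m : (n <= m)%N ->
    (\int[leb]_x ((v_ m x - v_ n x) ^+ 2)%:E <= (P * M * (8 ^+ n)^-1)%:E)%E.
  move=> nm; apply: (le_trans (PP _ (subH _ _ (v_H m) (v_H n)))).
  by rewrite lee_fin -mulrA ler_wpM2l ?(ltW P0)// v_cauchy.
have [v mv v_lim] := @Lfun2_fast_cauchy_cvg _ _ _ leb v_ (P * M) mv_
  (fun n => sqr_le n n.+1 (leqnSn n)).
have gv_lim : {ae leb2, forall z, gdiff (v_ n) z @[n --> \oo] --> gdiff v z}.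
  have v_lim1 : {ae leb2, forall z, v_ n z.1 @[n --> \oo] --> v z.1}.
    exact: (ae_fst _ v_lim).
  have v_lim2 : {ae leb2, forall z, v_ n z.2 @[n --> \oo] --> v z.2}.
    exact: (ae_snd _ v_lim).
  apply: filterS2 v_lim1 v_lim2 => z v1 v2.
  by apply: cvgM; [exact: cvgB|exact: cvg_cst].
have subL n : (\int[leb]_x ((v_ n x - v x) ^+ 2)%:E < +oo)%E.
  apply: le_lt_trans (ltry (P * M * (8 ^+ n)^-1)).
  (* With [n] fixed and [m] growing, the shifted index [m + n] is never below [n], so the Cauchy
     bound holds for every [m]. *)
  apply: (@fatou_sqr _ _ _ leb (fun m x => v_ n x - v_ (m + n)%N x)).
  - by move=> m; exact: measurable_funB.
  - exact: measurable_funB.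
  - apply: filterS v_lim => x v_limx; apply: cvgB; first exact: cvg_cst.
    by rewrite (cvg_shiftn n (v_ ^~ x)).
  - move=> m; apply: le_trans (sqr_le n (m + n)%N (leq_addl _ _)).
    by under eq_integral do rewrite -sqrrN opprB.
have gsub_le n : (\int[leb2]_z (gdiff (v_ n \- v) z ^+ 2)%:E <=
    (c^-1 * (M * (8 ^+ n)^-1))%:E)%E.
  apply: (@fatou_sqr _ _ _ leb2 (fun m => gdiff (v_ n \- v_ (m + n)%N))).
  - by move=> m; apply: measurable_gdiff; exact: measurable_funB.
  - by apply: measurable_gdiff; exact: measurable_funB.
  - apply: filterS gv_lim => z gv_limz.
    rewrite subE gdiff_lin.
    rewrite (_ : (fun m => _) =
        fun m => -1 * gdiff (v_ (m + n)%N) z + gdiff (v_ n) z); last first.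
      by apply/funext => m; rewrite subE gdiff_lin.
    apply: cvgD; last exact: cvg_cst.
    apply: cvgM; first exact: cvg_cst.
    by rewrite (cvg_shiftn n (fun n => gdiff (v_ n) z)).
  - move=> m; rewrite bilin_sqr; last exact: (subH _ _ (v_H _) (v_H _)).1.
    rewrite lee_fin ler_wpM2l ?invr_ge0 ?(ltW c_gt0)//.
    have := v_cauchy n (m + n)%N (leq_addl _ _).
    rewrite !bilinE; congr (_ * _ <= _); apply: eq_Rintegral => z _.
    by rewrite /gdiff/=; ring.
have subHs n : Hs alpha (v_ n \- v).
  apply/HsP; split; apply/Lfun2P; split.
  - exact: measurable_funB.
  - exact: subL.
  - by apply: measurable_gdiff; exact: measurable_funB.
  - exact: le_lt_trans (gsub_le n) (ltry _).
exists v => [|n].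
  split.
    (* Only the differences [v_ n - v] are known to lie in [Hs]; writing [v = v_ 0 - (v_ 0 - v)]
       gives membership of [v]. *)
    rewrite (_ : v = fun x => -1 * (v_ 0%N \- v) x + v_ 0%N x).
      by apply: Hs_lin => //; exact: (v_H 0%N).1.
    by apply/funext => x /=; ring.
  have v_0 : {ae leb, forall x, forall n, ~ closure O x -> v_ n x = 0}.
    by apply/ae_foralln => n; exact: (v_H n).2.
  apply: filterS2 v_0 v_lim => x vn0 vx Ox.
  apply/esym/(cvg_unique _ _ vx) => //.
  rewrite (_ : v_ ^~ x = fun=> 0); first exact: cvg_cst.
  by apply/funext => n; exact: vn0.
have := gsub_le n; rewrite bilin_sqr// lee_fin.
by rewrite ler_pM2l ?invr_gt0.
Qed.

Lemma weak_solution_ex g : L2 O g -> exists y, weak_solution O alpha g y.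
Proof.
move=> gL; have [P P0 PP] := Htilde_sqr_le.
have mO := open_measurable_row O_open.
have HL v : Htilde v -> L2 O v by move=> [[vL _] _]; exact: L2_Lfun.
(* The constant [K = P / 2 * (g, g)] comes from expanding the square of [u - P g] and using
   [(u, u) <= P * bilin u u]. The codomain [R^o] makes the functions a module over [R]. *)
have [|t u v uH vH|u v uH vH|t u v w uH vH wH|u uH|t u v uH vH|u uH|v_ M vH vM|y yH yP] :=
  @riesz_representation R ('rV[R]_d -> R^o) Htilde bilin (L2dot O g)
    (P / 2 * \int[leb]_x ((g \_ O) x * (g \_ O) x)).
- exact: Htilde0.
- exact: Htilde_lin.
- exact: bilin_sym.
- exact: bilin_lin uH.1 vH.1 wH.1.
- exact: bilin_ge0.
- by apply: L2dot_linr => //; exact: HL.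
- have := L2dot_ge0 O (fun x => - P * g x + u x).
  rewrite L2dot_sqr_lin//; last exact: HL.
  have := L2dot_le_integral mO uH.1.1 (PP u uH).
  rewrite -L2dotE -(ler_pM2l P0) => uP uP0; rewrite -(ler_pM2l P0).
  move: uP; rewrite ler_pM2l// => uP; nra.
- have [v ? ?] := Htilde_complete vH vM; by exists v.
by exists y; split.
Qed.

(** The difference of two solutions has zero energy, hence zero L2 norm by coercivity. *)
Lemma weak_solution_unique g u v : weak_solution O alpha g u ->
  weak_solution O alpha g v -> {ae leb, forall x, u x = v x}.
Proof.
move=> [uH uP] [vH vP]; have [P P0 PP] := Htilde_sqr_le.
pose w x := -1 * v x + u x.
have wH : Htilde w by exact: Htilde_lin.
have w0 : (\int[leb]_x `|(w x ^+ 2)%:E| = 0)%E.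
  apply/eqP; rewrite eq_le integral_ge0 ?andbT; last by move=> x _.
  under eq_integral => x _ do rewrite gee0_abs ?lee_fin ?sqr_ge0//.
  apply: (le_trans (PP w wH)); rewrite (bilin_lin _ vH.1 uH.1 wH.1).
  by rewrite uP// vP// mulN1r addNr mulr0.
have mw : measurable_fun setT (fun x => (w x ^+ 2)%:E).
  apply/measurable_EFinP/measurable_funX.
  by have [[wL _] _] := wH; exact: measurable_Lfun2 wL.
have /(ae_eq_integral_abs leb measurableT mw) := w0.
apply: filterS => x /(_ I) [] /eqP; rewrite sqrf_eq0 /w mulN1r addrC subr_eq0.
by move/eqP.
Qed.

End weak_solution_existence.

(** * Pointwise optimality *)

Section ae_sign.
Context d (T : measurableType d) (R : realType).
Variables (mu : {measure set T -> \bar R}) (F : T -> R).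
Hypothesis F_int : mu.-integrable setT (EFin \o F).

Lemma Rintegral_ae_ge0 : {ae mu, forall x, 0 <= F x} -> 0 <= \int[mu]_x F x.
Proof.
move=> F0; have mF := measurable_int mu F_int; apply: fine_ge0.
rewrite (@ae_eq_integral _ _ _ mu setT (fun x => `|(F x)%:E|%E))//.
- exact: integral_ge0.
- exact: measurableT_comp.
- by apply: filterS F0 => x F0 _; rewrite gee0_abs.
Qed.

(** The integral of [|F|] is minus that of [F], hence at most 0. *)
Lemma ae_eq0_of_Rintegral_ge0 : {ae mu, forall x, F x <= 0} ->
  0 <= \int[mu]_x F x -> {ae mu, forall x, F x = 0}.
Proof.
move=> F_le0 I_ge0; have mF := measurable_int mu F_int.
have : (\int[mu]_x `|(F x)%:E| = 0)%E.
  rewrite (@ae_eq_integral _ _ _ mu setT (fun x => (- (F x)%:E))%E)//; last 3 first.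
  - exact: measurableT_comp.
  - exact: measurableT_comp.
  - by apply: filterS F_le0 => x F0 _; rewrite lee0_abs.
  apply/eqP; rewrite eq_le; apply/andP; split.
    under eq_integral do rewrite -EFinN.
    rewrite -[leLHS]fineK; last first.
      apply: integrable_fin_num => //.
      by have := integrableN F_int; apply: eq_integrable.
    rewrite lee_fin -/(Rintegral _ _ _).
    have -> : \int[mu]_x - F x = - \int[mu]_x F x.
      under eq_Rintegral do rewrite -mulN1r.
      by rewrite RintegralZl// mulN1r.
    by rewrite oppr_le0.
  rewrite (@ae_eq_integral _ _ _ mu setT (fun x => `|(F x)%:E|%E))//.
  - exact: integral_ge0.
  - exact: measurableT_comp.
  - exact: measurableT_comp.
  - by apply: filterS F_le0 => x F0 _; rewrite lee0_abs.
move=> /(ae_eq_integral_abs mu measurableT mF); apply: filterS => x /(_ I) [].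
by [].
Qed.

End ae_sign.

(** * The scalar problem of minimizing [q s + beta |s|] over [[a, b]] *)

Section pointwise.
Context {R : realFieldType}.
Variables (beta a b : R).
Hypotheses (beta_gt0 : 0 < beta) (a_lt0 : a < 0) (b_gt0 : 0 < b).
Implicit Types q s u : R.

(** The objective has slope [q - beta] left of 0 and [q + beta] right of 0, so an end of the
    interval or 0 is a minimizer. For [|q| = beta] minimizers are not unique and 0 is chosen. *)
Definition bangbang q := if q < - beta then b else if beta < q then a else 0.

Definition sign_multiplier q := Num.max (-1) (Num.min 1 (- (q / beta))).

Lemma bangbang_itv q : a <= bangbang q <= b.
Proof.
move: a_lt0 b_gt0 => a0 b0.
by rewrite /bangbang; case: ifP => _; [|case: ifP => _]; apply/andP; split; lra.
Qed.

Lemma bangbang_min q s : a <= s <= b ->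
  q * bangbang q + beta * `|bangbang q| <= q * s + beta * `|s|.
Proof.
move: beta_gt0 a_lt0 b_gt0 => c0 a0 b0.
move=> /andP[? ?]; rewrite /bangbang; case: ltP => q1; [|case: ltP => q2].
- rewrite (gtr0_norm b_gt0); case: (ger0P s) => s0.
    by have : 0 <= (- beta - q) * (b - s); [apply: mulr_ge0; lra|lra].
  have : 0 <= (- beta - q) * b by apply: mulr_ge0; lra.
  by have : 0 <= (beta - q) * - s; [apply: mulr_ge0; lra|lra].
- rewrite (ltr0_norm a_lt0); case: (ger0P s) => s0; last first.
    by have : 0 <= (q - beta) * (s - a); [apply: mulr_ge0; lra|lra].
  have : 0 <= (q - beta) * - a by apply: mulr_ge0; lra.
  by have : 0 <= (q + beta) * s; [apply: mulr_ge0; lra|lra].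
- rewrite normr0; case: (ger0P s) => s0.
    by have : 0 <= (q + beta) * s; [apply: mulr_ge0; lra|lra].
  by have : 0 <= (beta - q) * - s; [apply: mulr_ge0; lra|lra].
Qed.

(** The cases match the branches of [bangbang]; in the last one the truncation is inactive. *)
Lemma sign_multiplierP q : [\/ [/\ q < - beta & sign_multiplier q = 1],
  [/\ beta < q & sign_multiplier q = -1] |
  [/\ - beta <= q, q <= beta & beta * sign_multiplier q = - q]].
Proof.
move: (beta_gt0) => c0; rewrite /sign_multiplier; have [q1|q1] := ltP q (- beta).
  have -> : Num.min 1 (- (q / beta)) = 1.
    by apply: min_l; rewrite -mulNr ler_pdivlMr//; lra.
  by constructor 1; split=> //; apply: max_r; lra.
have -> : Num.min 1 (- (q / beta)) = - (q / beta).
  by apply: min_r; rewrite -mulNr ler_pdivrMr//; lra.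
have [q2|q2] := ltP beta q.
  by constructor 2; split=> //; apply: max_l; rewrite -mulNr ler_pdivrMr//; lra.
constructor 3; split=> //; rewrite max_r; last by rewrite -mulNr ler_pdivlMr//; lra.
by rewrite mulrN mulrC divfK// gt_eqF.
Qed.

Lemma sign_multiplier_norm q : `|sign_multiplier q| <= 1.
Proof.
have [[_ ->]|[_ ->]|[q1 q2 qE]] := sign_multiplierP q; rewrite ?normrN ?normr1//.
by rewrite -(ler_pM2l beta_gt0) -[X in X * _](gtr0_norm beta_gt0) -normrM qE
  normrN mulr1 ler_norml q1 q2.
Qed.

(** Lets the multiplier commute with extension by zero. *)
Lemma sign_multiplier0 : sign_multiplier 0 = 0.
Proof.
by rewrite /sign_multiplier mul0r oppr0 min_r ?ler01// max_r// lerN10.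
Qed.

(** If [|q| > beta] the minimizer is unique, so [u] is an end of the interval and
    [q + beta * sign_multiplier q] has the sign that makes this end optimal. Otherwise that
    coefficient vanishes, and equality of the values reads [q * u + beta * |u| = 0]. *)
Lemma sign_multiplier_optimal q u : a <= u <= b ->
  q * bangbang q + beta * `|bangbang q| = q * u + beta * `|u| ->
  sign_multiplier q * u = `|u| /\
  forall s, a <= s <= b -> 0 <= (q + beta * sign_multiplier q) * (s - u).
Proof.
move: (beta_gt0) (a_lt0) (b_gt0) => c0 a0 b0.
move=> /andP[au ub]; rewrite /bangbang.
have [[q1 ->]|[q1 ->]|[q1 q2 qE]] := sign_multiplierP q.
- rewrite q1 (gtr0_norm b_gt0) => E.
  have uE : u = b.
    apply/eqP; rewrite eq_le ub leNgt; apply/negP => ltub.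
    move: E; case: (ger0P u) => u0 E.
      by have : 0 < (- beta - q) * (b - u); [apply: mulr_gt0; lra|lra].
    have : 0 < (- beta - q) * b by apply: mulr_gt0; lra.
    by have : 0 < (beta - q) * - u; [apply: mulr_gt0; lra|lra].
  rewrite uE (gtr0_norm b_gt0) mul1r; split=> // s /andP[? ?].
  by have : 0 <= (- beta - q) * (b - s); [apply: mulr_ge0; lra|lra].
- rewrite ifF ?q1; last by apply/negbTE; rewrite -leNgt; lra.
  rewrite (ltr0_norm a_lt0) => E.
  have uE : u = a.
    apply/eqP; rewrite eq_le au andbT leNgt; apply/negP => ltau.
    move: E; case: (ger0P u) => u0 E; last first.
      by have : 0 < (q - beta) * (u - a); [apply: mulr_gt0; lra|lra].
    have : 0 < (q - beta) * - a by apply: mulr_gt0; lra.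
    by have : 0 <= (q + beta) * u; [apply: mulr_ge0; lra|lra].
  rewrite uE (ltr0_norm a_lt0) mulN1r; split=> // s /andP[? ?].
  by have : 0 <= (q - beta) * (s - a); [apply: mulr_ge0; lra|lra].
- rewrite !ifF; last 2 first.
  + by apply/negbTE; rewrite -leNgt.
  + by apply/negbTE; rewrite -leNgt.
  rewrite normr0 !mulr0 addr0 => E; split; last first.
    by move=> s _; rewrite qE subrr mul0r.
  by apply: (mulfI (lt0r_neq0 beta_gt0)); rewrite mulrA qE; lra.
Qed.

End pointwise.

(** * The optimal control problem *)

Section bounded_domain.
Context {R : realType} {d : nat}.
Variable O : set 'rV[R]_d.
Hypotheses (mO : measurable O) (O_bnd : bounded_set O).
Local Notation leb := (@lebesgue_rV R d).
Implicit Types u v g : 'rV[R]_d -> R.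

Lemma lebesgue_rV_bounded_lty : (leb O < +oo)%E.
Proof.
have [M M0 OM] := closure_bounded_coord O_bnd.
pose E := [set x : 'rV[R]_d | forall i, x ord0 i \in `[- M, M]].
have mI : forall i : 'I_d, measurable ([set` `[- M, M]] : set R).
  by move=> i; exact: measurable_itv.
apply: (@le_lt_trans _ _ (leb E)).
  apply: le_measure; rewrite ?inE//; first exact: (measurable_row_box mI).
  move=> x Ox i; rewrite in_itv/= -ler_norml; apply: OM.
  exact: subset_closure.
rewrite (lebesgue_rV_box mI) ltey_eq prode_fin_num// => i _.
by rewrite lebesgue_measure_itv/=; case: ifP => // _; rewrite -EFinB.
Qed.

Lemma indic_Lfun2 : \1_O \in Lfun leb 2%:E.
Proof.
apply/Lfun2P; split; first exact: measurable_indic.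
rewrite (eq_integral (fun x => (\1_O x)%:E)); last first.
  by move=> x _; rewrite indicE; case: (_ \in _); rewrite ?expr1n ?expr0n.
by rewrite integral_indic// setIT; exact: lebesgue_rV_bounded_lty.
Qed.

Lemma bounded_L2 (C : R) v : measurable_fun setT (v \_ O) ->
  (forall x, O x -> `|v x| <= C) -> L2 O v.
Proof.
move=> mv vC; have C1L : (fun x => C * \1_O x + 0) \in Lfun leb 2%:E.
  apply: Lfun2_lin; first exact: indic_Lfun2.
  by apply/Lfun2P; split=> //; under eq_integral do rewrite expr0n/=;
    rewrite integral0 ltry.
apply: (Lfun2_le mv C1L) => x; rewrite addr0 patchE indicE.
case: ifPn => [/set_mem Ox|_]; last by rewrite normr0.
by rewrite mulr1 (le_trans (vC x Ox)) ?ler_norm.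
Qed.

Lemma L2B u v : L2 O u -> L2 O v -> L2 O (u \- v).
Proof.
move=> uL vL; rewrite (_ : u \- v = fun x => -1 * v x + u x); first exact: L2_lin.
by apply/funext => x /=; rewrite mulN1r addrC.
Qed.

(** Hoelder's inequality against the indicator of [O], which is square-integrable because [O] has
    finite measure. *)
Lemma integrable_L2 v : L2 O v -> leb.-integrable setT (EFin \o v \_ O).
Proof.
move=> vL; have := integrable_mul_Lfun2 vL indic_Lfun2.
apply: eq_integrable => // x _; rewrite /= patchE indicE.
by case: (x \in O); rewrite ?mulr1 ?mul0r.
Qed.

Lemma L2norm_sqr v : L2 O v -> L2norm O v ^+ 2 = L2dot O v v.
Proof. by move=> vL; rewrite /L2norm Lnorm2_sqr// L2dotE. Qed.

Lemma j2E v : j2 O v = \int[leb]_x `|(v \_ O) x|.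
Proof. by rewrite /j2 /L1norm Lnorm1. Qed.

Lemma integrable_norm_L2 v : L2 O v ->
  leb.-integrable setT (EFin \o (fun x => `|(v \_ O) x|)).
Proof. by move=> vL; apply: integrable_norm; exact: integrable_L2. Qed.

Lemma j2_convex t u v : 0 <= t <= 1 -> L2 O u -> L2 O v ->
  j2 O (fun x => t * (v \- u) x + u x) <= (1 - t) * j2 O u + t * j2 O v.
Proof.
move=> /andP[t0 t1] uL vL; rewrite !j2E.
have iu := integrable_norm_L2 uL; have iv := integrable_norm_L2 vL.
rewrite -!RintegralZl//.
have iZ s w : leb.-integrable setT (EFin \o w) ->
    leb.-integrable setT (EFin \o (fun x => s * w x)).
  by move=> wi; have := integrableZl measurableT s wi; apply: eq_integrable.
rewrite -RintegralD//; [|exact: iZ|exact: iZ].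
apply: le_Rintegral => //.
- by apply: integrable_norm_L2; apply: L2_lin => //; exact: L2B.
- by have := integrableD measurableT (iZ (1 - t) _ iu) (iZ t _ iv); apply: eq_integrable.
- move=> x _; rewrite !patchE; case: ifP => _; last by rewrite normr0 !mulr0 addr0.
  rewrite (_ : t * _ + _ = (1 - t) * u x + t * v x); last by rewrite /=; ring.
  apply: le_trans (ler_normD _ _) _; rewrite !normrM.
  by rewrite (ger0_norm t0) ger0_norm// subr_ge0.
Qed.

End bounded_domain.

(** * First-order optimality and construction of the multiplier *)

Section optimality.
Context {R : realType} {d : nat}.
Variables (O : set 'rV[R]_d) (alpha gamma beta a b : R) (f yd u : 'rV[R]_d -> R).
Hypotheses (d_gt0 : (0 < d)%N) (alpha_gt0 : 0 < alpha) (alpha_lt2 : alpha < 2).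
Hypotheses (O_open : open O) (O_bnd : bounded_set O).
Hypotheses (gamma_gt0 : 0 < gamma) (beta_gt0 : 0 < beta) (a_lt0 : a < 0) (b_gt0 : 0 < b).
Hypotheses (f_L2 : L2 O f) (yd_L2 : L2 O yd) (u_ad : Uad O a b u).
Hypothesis u_min : forall v, Uad O a b v ->
  Jhat O alpha gamma beta f yd u <= Jhat O alpha gamma beta f yd v.
Local Notation leb := (@lebesgue_rV R d).
Local Notation S := (solution_operator O alpha).
Implicit Types v w g h : 'rV[R]_d -> R.

Let mO : measurable O. Proof. exact: open_measurable_row. Qed.

Lemma solution_operatorP g : L2 O g -> weak_solution O alpha g (S g).
Proof.
move=> gL; have [y yP] := weak_solution_ex d_gt0 alpha_gt0 alpha_lt2 O_open O_bnd gL.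
exact: (xgetPex (cst 0) (ex_intro _ y yP)).
Qed.

Lemma weak_solution_lin t g h y z : L2 O g -> L2 O h ->
  weak_solution O alpha g y -> weak_solution O alpha h z ->
  weak_solution O alpha (fun x => t * g x + h x) (fun x => t * y x + z x).
Proof.
move=> gL hL [yH yP] [zH zP]; split; first exact: Htilde_lin.
move=> v vH; rewrite (bilin_lin _ yH.1 zH.1 vH.1) yP// zP// L2dot_linl//.
exact/(L2_Lfun mO)/vH.1.1.
Qed.

Lemma weak_solution_L2 g y : weak_solution O alpha g y -> L2 O y.
Proof. by move=> [yH _]; exact/(L2_Lfun mO)/yH.1.1. Qed.

(** [xget] chooses a representative for each right-hand side separately, so linear relations between
    states hold only a.e.; norms do not see the difference. *)
Lemma L2dot_ae_eq v w : L2 O v -> L2 O w -> {ae leb, forall x, v x = w x} ->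
  L2dot O v v = L2dot O w w.
Proof.
move=> vL wL vw; rewrite !L2dotE; congr fine; apply: ae_eq_integral => //.
- exact: measurable_int (integrable_mul_Lfun2 vL vL).
- exact: measurable_int (integrable_mul_Lfun2 wL wL).
- by apply: filterS vw => x vw _; rewrite !patchE vw.
Qed.

(** The expansion is exact: by uniqueness the perturbed state is a.e. [t * S h + S (f + u)]. The
    coefficient of [t] is the directional derivative. *)
Lemma j1_direction t h : L2 O h -> j1 O alpha gamma f yd (fun x => t * h x + u x) =
  j1 O alpha gamma f yd u
  + t * (L2dot O (S (f \+ u) \- yd) (S h) + gamma * L2dot O u h)
  + t ^+ 2 / 2 * (L2dot O (S h) (S h) + gamma * L2dot O h h).
Proof.
move=> hL; have uL := u_ad.1.
have fuL : L2 O (f \+ u).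
  rewrite (_ : f \+ u = fun x => 1 * f x + u x); first exact: L2_lin.
  by apply/funext => x /=; rewrite mul1r.
have hu : L2 O (fun x => t * h x + u x) by exact: L2_lin.
have futE : f \+ (fun x => t * h x + u x) = fun x => t * h x + (f \+ u) x.
  by apply/funext => x /=; ring.
have futL : L2 O (f \+ (fun x => t * h x + u x)) by rewrite futE; exact: L2_lin.
have Sfu := solution_operatorP fuL; have Sh := solution_operatorP hL.
have Sfut := solution_operatorP futL.
have eL : L2 O (S (f \+ u) \- yd) by exact/L2B/yd_L2/(weak_solution_L2 Sfu).
have ShL := weak_solution_L2 Sh.
rewrite /j1 !L2norm_sqr//; last exact: L2B (weak_solution_L2 Sfut) yd_L2.
rewrite (@L2dot_ae_eq _ (fun x => t * S h x + (S (f \+ u) \- yd) x)).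
- by rewrite !L2dot_sqr_lin// (L2dot_sym O (S h)) (L2dot_sym O h); field.
- exact: L2B (weak_solution_L2 Sfut) yd_L2.
- exact: L2_lin.
have := weak_solution_lin t hL fuL Sh Sfu; rewrite -futE => lin.
have := weak_solution_unique d_gt0 alpha_gt0 alpha_lt2 O_bnd Sfut lin.
by apply: filterS => x /= ->; ring.
Qed.

Lemma control_variational_inequality p v :
  adjoint_state O alpha yd (S (f \+ u)) p -> Uad O a b v ->
  0 <= L2dot O (fun x => gamma * u x + p x) (v \- u) + beta * (j2 O v - j2 O u).
Proof.
move=> [pH pP] vad; have [uL u_ab] := u_ad; have [vL v_ab] := vad.
have hL : L2 O (v \- u) by exact: L2B.
have Sh := solution_operatorP hL.
have pL : L2 O p by exact/(L2_Lfun mO)/pH.1.1.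
rewrite L2dot_linl//.
(* Duality: the adjoint equation is tested with [S (v - u)] and the equation of [S (v - u)] with
   [p]. *)
have pE : L2dot O p (v \- u) = L2dot O (S (f \+ u) \- yd) (S (v \- u)).
  by rewrite -(pP _ Sh.1) (Sh.2 _ pH) L2dot_sym.
rewrite pE; set A := L2dot _ _ _; set B := L2dot O (_ \- yd) _.
pose C := L2dot O (S (v \- u)) (S (v \- u)) + gamma * L2dot O (v \- u) (v \- u).
(* Minimality against [u + t (v - u)] and convexity of [j2], divided by [t]; [C] is the second
   derivative of [j1] along [v - u]. *)
have step t : 0 < t -> t <= 1 ->
    - (gamma * A + B + beta * (j2 O v - j2 O u)) <= t / 2 * C.
  move=> t0 t1; pose ut x := t * (v \- u) x + u x.
  have ut_ad : Uad O a b ut.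
    split; first exact: L2_lin.
    apply: filterS2 u_ab v_ab => x /[swap] vx /[swap] Ox /(_ Ox) /andP[? ?].
    have /andP[? ?] := vx Ox.
    have e0 : 0 <= t * (v x - a) by apply: mulr_ge0; lra.
    have e1 : 0 <= (1 - t) * (u x - a) by apply: mulr_ge0; lra.
    have e2 : 0 <= t * (b - v x) by apply: mulr_ge0; lra.
    have e3 : 0 <= (1 - t) * (b - u x) by apply: mulr_ge0; lra.
    by rewrite /ut/=; apply/andP; split; lra.
  have t01 : 0 <= t <= 1 by rewrite (ltW t0).
  have := u_min ut_ad; rewrite /Jhat /ut j1_direction// -/ut -/A -/B -/C.
  have := ler_wpM2l (ltW beta_gt0) (j2_convex mO O_bnd t01 uL vL).
  rewrite -/ut expr2 => convex_le min_le; rewrite -(ler_pM2l t0).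
  by move: convex_le min_le; set X := j2 O ut; lra.
rewrite -oppr_le0; apply: (@le0_of_le_expr2N _ _ (C / 2)) => n.
have := step (2 ^+ n)^-1; rewrite invr_gt0 exprn_gt0// => /(_ isT).
rewrite invf_le1 ?exprn_gt0// exprn_ege1 ?ler1n// => /(_ isT).
by move=> /le_trans; apply; rewrite le_eqVlt; apply/orP; left; apply/eqP; ring.
Qed.

Lemma optimality_multiplier p : adjoint_state O alpha yd (S (f \+ u)) p ->
  exists lambda, subdiff_j2 O u lambda /\
    forall v, Uad O a b v ->
      0 <= L2dot O (fun x => p x + gamma * u x + beta * lambda x) (v \- u).
Proof.
move=> pP; have [uL u_ab] := u_ad.
have pL : L2 O p by exact/(L2_Lfun mO)/pP.1.1.1.
pose q x := gamma * u x + p x; have qL : L2 O q by exact: L2_lin.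
pose lambda x := sign_multiplier beta (q x).
have lambdaL : L2 O lambda.
  apply: (@bounded_L2 _ _ _ mO O_bnd 1); last first.
    by move=> x _; exact: sign_multiplier_norm.
  rewrite (_ : lambda \_ O = sign_multiplier beta \o (q \_ O)); last first.
    by apply/funext => x; rewrite /= !patchE; case: ifP; rewrite ?sign_multiplier0.
  have mq := measurable_Lfun2 qL.
  apply: measurable_maxr => //; apply: measurable_minr => //.
  by apply: measurableT_comp => //; exact: measurable_funM.
pose w x := bangbang beta a b (q x).
have w_ad : Uad O a b w.
  split; last by apply: aeW => x _; exact: bangbang_itv.
  (* As [a < 0 < b], the width [b - a] dominates both [|a|] and [|b|]. *)
  apply: (@bounded_L2 _ _ _ mO O_bnd (b - a)); last first.
    move=> x _; have := bangbang_itv beta a_lt0 b_gt0 (q x).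
    by rewrite -/(w x) ler_norml => /andP[? ?]; move: (a_lt0) (b_gt0) => ? ?;
      apply/andP; split; lra.
  have mq := measurable_Lfun2 qL.
  rewrite (_ : w \_ O = bangbang beta a b \o (q \_ O)); last first.
    apply/funext => x; rewrite /= !patchE; case: ifP => // _.
    by rewrite /bangbang ltNge oppr_le0 (ltW beta_gt0)/= ltNge (ltW beta_gt0).
  apply: measurable_fun_ifT => //; first exact: measurable_fun_ltr.
  by apply: measurable_fun_ifT => //; exact: measurable_fun_ltr.
have wL := w_ad.1.
have u_min_ae : {ae leb, forall x, O x ->
    q x * w x + beta * `|w x| = q x * u x + beta * `|u x|}.
  pose F x := (q \_ O) x * ((w \- u) \_ O) x +
    beta * (`|(w \_ O) x| - `|(u \_ O) x|).
  have Fint1 := integrable_mul_Lfun2 qL (L2B wL uL).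
  have Fint2 := integrableB measurableT (integrable_norm_L2 mO O_bnd wL)
    (integrable_norm_L2 mO O_bnd uL).
  have Fint3 := integrableZl measurableT beta Fint2.
  have F_int : leb.-integrable setT (EFin \o F).
    by have := integrableD measurableT Fint1 Fint3; apply: eq_integrable.
  have F0 : {ae leb, forall x, F x = 0}.
    apply: ae_eq0_of_Rintegral_ge0 F_int _ _.
      apply: filterS u_ab => x u_ab; rewrite /F !patchE; case: ifPn.
        move=> /set_mem /u_ab /(bangbang_min beta_gt0 a_lt0 b_gt0 (q x)).
        by rewrite -/(w x)/=; lra.
      by rewrite normr0 mul0r subrr mulr0 addr0.
    rewrite /F RintegralD// RintegralZl// RintegralB//; last 2 first.
    - exact: integrable_norm_L2.
    - exact: integrable_norm_L2.
    by rewrite -!j2E -L2dotE; exact: control_variational_inequality.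
  apply: filterS F0 => x + Ox; rewrite /F !patchE mem_set//=; lra.
have point : {ae leb, forall x, O x -> lambda x * u x = `|u x| /\
    forall s, a <= s <= b -> 0 <= (q x + beta * lambda x) * (s - u x)}.
  apply: filterS2 u_min_ae u_ab => x + + Ox => /(_ Ox) E /(_ Ox) uab.
  exact: sign_multiplier_optimal.
exists lambda; split; [split=> // v vL|move=> v [vL v_ab]].
  rewrite !j2E L2dotE -subr_ge0.
  have iv := integrable_norm_L2 mO O_bnd vL; have iu := integrable_norm_L2 mO O_bnd uL.
  have il := integrable_mul_Lfun2 lambdaL (L2B vL uL).
  have ivu := integrableB measurableT iv iu.
  rewrite -RintegralB// -RintegralB//; apply: Rintegral_ae_ge0.
    by have := integrableB measurableT ivu il; apply: eq_integrable.
  apply: filterS point => x; rewrite !patchE; case: ifPn => [/set_mem Ox|_ _]; last first.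
    by rewrite normr0 mul0r !subrr.
  move=> /(_ Ox)[lu _] /=.
  (* The subgradient inequality holds pointwise: [|lambda| <= 1] gives this bound, and it is an
     equality at [u]. *)
  have : lambda x * v x <= `|v x|.
    apply: le_trans (ler_norm _) _; rewrite normrM ler_piMl//.
    exact: sign_multiplier_norm.
  by rewrite mulrBr lu; lra.
rewrite L2dotE; apply: Rintegral_ae_ge0.
  apply: integrable_mul_Lfun2; last exact: L2B.
  rewrite (_ : (fun x => p x + _ + _) = fun x => beta * lambda x + q x).
    exact: L2_lin.
  by apply/funext => x; rewrite /q; ring.
apply: filterS2 point v_ab => x; rewrite !patchE.
case: ifPn => [/set_mem Ox|_ _ _]; last by rewrite mul0r.
move=> /(_ Ox)[_ /(_ (v x)) +] /(_ Ox) vx => /(_ vx).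
by rewrite /q/=; congr (0 <= _ * _); ring.
Qed.

End optimality.

Theorem theorem3p1 (R : realType) (d : nat) (Omega : set 'rV[R]_d)
    (alpha gamma beta a b : R) (f yd u y p : 'rV[R]_d -> R)
    (d_gt0 : (0 < d)%N)
    (Omega_lip : bounded_lipschitz_domain Omega)
    (alpha_gt0 : 0 < alpha) (alpha_lt2 : alpha < 2)
    (gamma_gt0 : 0 < gamma) (beta_gt0 : 0 < beta)
    (a_lt0 : a < 0) (b_gt0 : 0 < b)
    (f_L2 : L2 Omega f) (yd_L2 : L2 Omega yd)
    (u_ad : Uad Omega a b u)
    (u_min : forall v, Uad Omega a b v ->
      Jhat Omega alpha gamma beta f yd u <= Jhat Omega alpha gamma beta f yd v)
    (y_state : y = solution_operator Omega alpha (f \+ u))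
    (p_adjoint : adjoint_state Omega alpha yd y p) :
  exists lambda, subdiff_j2 Omega u lambda /\
    forall v, Uad Omega a b v ->
      0 <= L2dot Omega (fun x => p x + gamma * u x + beta * lambda x)
        (v \- u).
Proof.
case: Omega_lip => _ Omega_open _ Omega_bnd _; move: p_adjoint; rewrite y_state.
exact: (optimality_multiplier d_gt0 alpha_gt0 alpha_lt2 Omega_open Omega_bnd
  beta_gt0 a_lt0 b_gt0 f_L2 yd_L2 u_ad u_min).
Qed.
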